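(* Let $(E,C)$ be a separated graph. Then the Leavitt inverse semigroup $\mathcal{LI}(E,C)$ is isomorphic to the inverse semigroup consisting of all Leavitt–Munn $(E,C)$-trees (together with $0$), endowed with the product $$(T_1,g_1)\cdot (T_2,g_2)=\begin{cases}\big((T_1'\cup g_1\cdot T_2')_L,\; g_1\cdot g_2\big) & \text{if } r(g_1)=s(g_2) \text{ and } T_1'\cup g_1\cdot T_2' \text{ is } C\text{-compatible},\\ 0&\text{otherwise,}\end{cases}$$ where $T_1',T_2'\in\mathcal X$ are any representatives of $T_1$ and $T_2$ respectively such that $g_1\in T_1'$ and $g_2\in T_2'$. The inverse is given by $(T,g)^{-1}=((g^{-1}\cdot T')_L,g^{-1})$, where $T'$ is any representative of $T$ such that $g\in T'$. The map $(T,g)\mapsto \omega(g)$ provides an idempotent pure partial homomorphism $\mathcal{LI}(E,C)^\times\to\mathbb F$, where $\mathbb F=\mathbb F(E^1)$ is the free group on $E^1$, and it determines a restricted semidirect product decomposition $$\mathcal{LI}(E,C)\cong \mathcal Y^L\rtimes^r_{\theta^L}\mathbb F,$$ where $\mathcal Y^L=\mathcal X/{\sim_L}$ is isomorphic to the semilattice of idempotents of $\mathcal{LI}(E,C)$. The partial action $\theta^L$, with $\theta_g^L\colon D^L_{g^{-1}}\to D^L_g$, is as follows: for each $v\in E^0$ and $g\in\mathbb F_C(v)\setminus\{v\}$, (the nonzero part of) $D_g^L$ can be identified with the set of all $T\in\mathcal X_L(v)$ such that $g_L\in T$, and $\theta_g^L(T)=(g\cdot T')_L$ for $T\in D^L_{g^{-1}}$,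 where $T'$ is a representative of $T$ containing $g^{-1}$.
   Context: Graphs and paths. A directed graph $E=(E^0,E^1,s,r)$ has arbitrary sets of vertices and edges and source/range maps $s,r$. A separated graph $(E,C)$ is a directed graph with $C=\bigsqcup_{v\in E^0}C_v$, where $C_v$ is a partition of $s^{-1}(v)$ into pairwise disjoint nonempty subsets ($C_v=\emptyset$ if $s^{-1}(v)=\emptyset$). For $e\in E^1$ let $e^{-1}$ be a formal inverse with $s(e^{-1})=r(e)$, $r(e^{-1})=s(e)$; put $E^{-1}=\{e^{-1}:e\in E^1\}$, $\hat E^1=E^1\cup E^{-1}$, $(e^{-1})^{-1}=e$. A path is a vertex or a sequence $y_1\cdots y_n$ in $\hat E^1$ with $r(y_i)=s(y_{i+1})$; it is reduced if it has no subpath $xx^{-1}$, $x\in\hat E^1$. The fundamental groupoid $\mathfrak F_{gr}(E)$ is the set of reduced paths with product $\alpha\cdot\beta=\mathrm{red}(\alpha\beta)$ (reduction of the concatenation) when $r(\alpha)=s(\beta)$; its units are the vertices. $\mathbb F(E^1)$ is the free group on $E^1$ and $\omega\colon\mathfrak F_{gr}(E)\to\mathbb F(E^1)$ sends vertices to $1$ and a reduced path $y_1\cdots y_n$ to the corresponding word. $\mu\le_p\nu$ means $\mu$ is a prefix of $\nu$ (the vertex $s(\nu)$ is a prefix of $\nu$); $A^\downarrow$ is the set of all prefixes of elements of $A$; a lower subset is one closed under prefixes; $\max(T)$ is the set of $\le_p$-maximal elements of $T$. $C$-compatible trees. A $C$-separated path is a reduced path having no subpath $x^{-1}y$ with $x,y\in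 X$, $X\in C$. $\mathbb F_C(v)$ is the set of $C$-separated paths with source $v$, and $\mathbb F_C=\bigsqcup_v\mathbb F_C(v)$. Elements $\gamma,\nu\in\mathbb F_C(v)$ are $C$-compatible if $\nu^{-1}\cdot\gamma\in\mathbb F_C$; a subset of $\mathbb F_C(v)$ is $C$-compatible if its elements are pairwise $C$-compatible. $\mathcal X(v)$ is the set of nonempty finite lower $C$-compatible subsets of $\mathbb F_C(v)$, and $\mathcal X=\bigsqcup_v\mathcal X(v)\sqcup\{0\}$ is a semilattice with $T\cdot S=T\cup S$ if $T,S$ lie in the same $\mathcal X(v)$ and $T\cup S$ is $C$-compatible, and $T\cdot S=0$ otherwise. $\mathcal X_L(v)$ is the set of $T\in\mathcal X(v)$ such that no maximal element of $T$ ends in an element of $E^{-1}$ or in an edge $e\in E^1$ with $\{e\}\in C$; $\mathcal X_L=\bigsqcup_v\mathcal X_L(v)$. Decomposition. Each $g\in\mathfrak F_{gr}(E)$ is uniquely $g=g_Lw$, where $g_L$ is $s(g)$ or a prefix of $g$ ending in an edge $e\in X\in C$ with $|X|>1$, and $w=x_1\cdots x_r$ ($r\ge0$) with each $x_i\in E^{-1}$ or $\{x_i\}\in C$. The relation $\sim_L$ on $\mathcal X$ is the congruence generated by $(ge^{-1})^\downarrow\sim_L g^\downarrow$ ($e\in E^1$, $ge^{-1}\in \mathbb F_C$ reduced as written) and $(ge)^\downarrow\sim_L g^\downarrow$ ($\{e\}\in C$, $ge\in\mathbb F_C$ reduced as written). For $T\in\mathcal X\setminus\{0\}$, $T_L=\{g_L:g\in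 T\}^\downarrow$; it is the unique element of $\mathcal X_L$ in the $\sim_L$-class of $T$. A representative of $T\in\mathcal X_L$ is any $T'\in\mathcal X$ with $T'\sim_LT$, i.e. $T'_L=T$. A Leavitt–Munn $(E,C)$-tree is a pair $(T,g)$ with $T\in\mathcal X_L$, $g\in\mathbb F_C$ and $g_L\in T$ (so $s(g)=v$ if $T\in\mathcal X_L(v)$). $\mathcal{LI}(E,C)$ is the universal inverse semigroup (with zero) generated by $E^0\cup E^1\cup E^{-1}$ subject to: (1) $vw=\delta_{v,w}v$ for $v,w\in E^0$; (2) $s(x)x=x$ and (3) $xr(x)=x$ for $x\in\hat E^1$; (4) $e^{-1}f=\delta_{e,f}r(e)$ for $e,f\in X$, $X\in C$; (5) $ee^{-1}=s(e)$ for $e\in E^1$ with $\{e\}\in C$. For an inverse semigroup $S$ with zero, $S^\times=S\setminus\{0\}$; a partial homomorphism to a group $\Gamma$ is a map $\pi\colon S^\times\to\Gamma$ with $\pi(st)=\pi(s)\pi(t)$ whenever $st\neq0$; it is idempotent pure if $\pi^{-1}(1)$ is the set of nonzero idempotents. For a partial action $\theta$ of $\Gamma$ on a semilattice $\mathcal E$ with zero, by isomorphisms $\theta_g\colon D_{g^{-1}}\to D_g$ between ideals, the restricted semidirect product $\mathcal E\rtimes_\theta^r\Gamma$ is $\{(a,g):0\ne a\in D_g\}\cup\{0\}$ with product $(a,g)(b,h)=(\theta_g(\theta_{g^{-1}}(a)b),gh)$, interpreted as $0$ when the first coordinate is $0$. Here $D_g^L=\{0\}$ when $g\ne1$ is not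 (the word of) an element of $\mathbb F_C$. *)

(* Defs.v *)
From HB Require Import structures.
From mathcomp Require Import all_boot.
From mathcomp Require Import finmap.
From mathcomp Require Import mathcomp_extra boolp classical_sets functions.

Set Implicit Arguments.
Unset Strict Implicit.
Unset Printing Implicit Defensive.

Local Open Scope quotient_scope.
Local Open Scope group_scope.

(* [magma0Type] only carries the data of a product and of a distinguished
   element [null]; that [null] is a zero and that the product is associative
   are part of the predicates below. *)

HB.mixin Record hasNull S := { null : S }.

#[short(type="magma0Type")]
HB.structure Definition Magma0 := {S of hasNull S & Magma S}.

Arguments null {s}.

Section SemigroupsWithZero.
Implicit Types S E : magma0Type.

Definition is_inverse S (s t : S) : Prop := s * t * s = s /\ t * s * t = t.

Definition semigroup0 S : Prop :=
  [/\ associative (@mul S), left_zero null (@mul S)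
    & right_zero null (@mul S)].

Definition inverse_semigroup0 S : Prop :=
  semigroup0 S /\ forall s : S, exists! t : S, is_inverse s t.

Definition semilattice0 S : Prop :=
  [/\ semigroup0 S, commutative (@mul S) & idempotent_op (@mul S)].

Definition morphism0 S S' (f : S -> S') : Prop :=
  {morph f : x y / x * y} /\ f null = null.

Definition isomorphism0 S S' (f : S -> S') : Prop :=
  bijective f /\ morphism0 f.

Definition idempotents S : set S := [set s | s * s = s].

(* Maps defined on the nonzero elements of [S] are represented by total
   functions on [S] whose value at [null] is irrelevant. *)
Definition partial_homomorphism S (Gam : groupType) (pi : S -> Gam) : Prop :=
  forall s t : S, s * t <> null -> pi (s * t) = pi s * pi t.

Definition idempotent_pure S (Gam : groupType) (pi : S -> Gam) : Prop :=
  forall s : S, s <> null -> (pi s = 1 <-> s * s = s).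

(* The isomorphism [theta_g : D_(g^-1) -> D_g] is represented by a total
   function [pact g] whose values outside [pdom g^-1] are irrelevant. *)
Record partial_action (Gam : groupType) E := PartialAction {
  pdom : Gam -> set E;
  pact : Gam -> E -> E;
  pdom_null : forall g, pdom g null;
  pdom_ideal : forall g a b,
    pdom g a -> pdom g (a * b) /\ pdom g (b * a);
  pact_bij : forall g, set_bij (pdom g^-1) (pdom g) (pact g);
  pact_mul : forall g a b, pdom g^-1 a -> pdom g^-1 b ->
    pact g (a * b) = pact g a * pact g b;
  pdom1 : pdom 1 = [set: E]%classic;
  pact1 : forall a, pact 1 a = a;
  pact_comp : forall g h a, pdom h^-1 a -> pdom g^-1 (pact h a) ->
    pdom (g * h)^-1 a /\ pact (g * h) a = pact g (pact h a)
}.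

Section RestrictedSemidirectProduct.
Variables (Gam : groupType) (E : magma0Type) (th : partial_action Gam E).

Definition sdp_pred (p : E * Gam) : bool := `[< p.1 <> null /\ pdom th p.2 p.1 >].

(* [None] is the zero element. *)
Definition sdp : Type := option {p : E * Gam | sdp_pred p}.

(* [insub] maps pairs with first coordinate [null] to [None];
   see [sdp_mem] for the other condition in [sdp_pred]. *)
Definition sdp_mul (x y : sdp) : sdp :=
  match x, y with
  | Some p, Some q =>
      let: (a, g) := val p in let: (b, h) := val q in
      insub (pact th g (pact th g^-1 a * b), g * h)
  | _, _ => None
  end.

HB.instance Definition _ := hasMul.Build sdp sdp_mul.
HB.instance Definition _ := hasNull.Build sdp None.

Lemma sdp_mem (a b : E) (g h : Gam) : pdom th g a -> pdom th h b ->
  pdom th (g * h) (pact th g (pact th g^-1 a * b)).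
Proof.
move=> ga hb; have [fung _ _] := pact_bij th g^-1.
have g'a : pdom th g^-1 (pact th g^-1 a) by apply: fung; rewrite /= invgK.
have [g'x _] := pdom_ideal b g'a.
have [_ hx] := pdom_ideal (pact th g^-1 a) hb.
have [_ _ surh] := pact_bij th h.
have [y h'y yx] := surh _ hx.
rewrite -yx in g'x *.
have [ghy <-] := pact_comp h'y g'x.
by have [fungh _ _] := pact_bij th (g * h); apply: fungh.
Qed.

End RestrictedSemidirectProduct.
End SemigroupsWithZero.

Definition sdp_val (Gam : groupType) (E : magma0Type) (th : partial_action Gam E)
  (x : sdp th) : option (E * Gam) := omap val x.

Section FreeGroup.
Variable X : choiceType.

(* [inl x] is the letter [x] and [inr x] is its formal inverse. *)
Definition linv (a : X + X) : X + X :=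
  match a with inl x => inr x | inr x => inl x end.

Definition reduced (w : seq (X + X)) : bool := sorted (fun a b => b != linv a) w.

Definition push (a : X + X) (w : seq (X + X)) : seq (X + X) :=
  if w is b :: w' then if b == linv a then w' else a :: w else [:: a].

Definition red (w : seq (X + X)) : seq (X + X) := foldr push [::] w.

Definition winv (w : seq (X + X)) : seq (X + X) := rev (map linv w).

Lemma linvK : involutive linv. Proof. by case. Qed.

Lemma push_reduced a w : reduced w -> reduced (push a w).
Proof.
case: w => [//|b w] rw /=; case: eqP => [_|/eqP ab]; last by rewrite /= ab.
exact: path_sorted rw.
Qed.

Lemma foldr_push_reduced b w : reduced b -> reduced (foldr push b w).
Proof. by move=> rb; elim: w => //= a w; apply: push_reduced. Qed.

Lemma red_reduced w : reduced (red w).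
Proof. exact: foldr_push_reduced. Qed.

Lemma pushK a w : reduced w -> push (linv a) (push a w) = w.
Proof.
case: w => [|b w] rw /=; first by rewrite linvK eqxx.
case: eqP => [eb|_] /=; last by rewrite linvK eqxx.
move: rw; rewrite {}eb; case: w => [//|c w] /= /andP[/negPf -> _].
by [].
Qed.

Lemma foldr_push b a w : reduced b ->
  foldr push b (push a w) = push a (foldr push b w).
Proof.
move=> rb; case: w => [//|c w] /=; case: eqP => [->|//].
by rewrite -[X in push X](linvK a) pushK //; apply: foldr_push_reduced.
Qed.

Lemma foldr_push_red b w : reduced b -> foldr push b (red w) = foldr push b w.
Proof. by move=> rb; elim: w => //= a w <-; apply: foldr_push. Qed.

Lemma red_id w : reduced w -> red w = w.
Proof.
elim: w => //= a w IH aw; rewrite IH; last exact: path_sorted aw.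
by case: w {IH} aw => //= b w /andP[/negPf ->].
Qed.

Lemma red_catl a b : red (red a ++ b) = red (a ++ b).
Proof. by rewrite /red !foldr_cat foldr_push_red //; apply: red_reduced. Qed.

Lemma red_catr a b : red (a ++ red b) = red (a ++ b).
Proof. by rewrite [LHS]foldr_cat [RHS]foldr_cat -/(red _) red_id ?red_reduced. Qed.

Lemma red_winvl w : red (winv w ++ w) = [::].
Proof.
elim: w => //= a w IH; rewrite /winv map_cons rev_cons cat_rcons -red_catr.
have -> : red [:: linv a, a & w] = red w by apply/pushK/red_reduced.
by rewrite red_catr.
Qed.

Lemma winvK : involutive winv.
Proof. by move=> w; rewrite /winv map_rev revK -map_comp map_id_in // => a _ /=; rewrite linvK. Qed.

Definition free_group : Type := {w : seq (X + X) | reduced w}.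

HB.instance Definition _ := Choice.on free_group.

Definition fg_word (w : seq (X + X)) : free_group := Sub (red w) (red_reduced w).

Definition fg_mul (g h : free_group) : free_group := fg_word (val g ++ val h).
Definition fg_inv (g : free_group) : free_group := fg_word (winv (val g)).

Lemma fg_mulA : associative fg_mul.
Proof. by move=> g h k; apply: val_inj; rewrite /= red_catl red_catr catA. Qed.

Lemma fg_mul1g : left_id (fg_word [::]) fg_mul.
Proof. by move=> g; apply: val_inj; rewrite /= red_id ?(valP g). Qed.

Lemma fg_mulg1 : right_id (fg_word [::]) fg_mul.
Proof. by move=> g; apply: val_inj; rewrite /= cats0 red_id ?(valP g). Qed.

Lemma fg_mulVg : left_inverse (fg_word [::]) fg_inv fg_mul.
Proof. by move=> g; apply: val_inj; rewrite /= red_catl red_winvl. Qed.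

Lemma fg_mulgV : right_inverse (fg_word [::]) fg_inv fg_mul.
Proof.
by move=> g; apply: val_inj; rewrite /= red_catr -{1}(winvK (val g)) red_winvl.
Qed.

HB.instance Definition _ :=
  isGroup.Build free_group fg_mulA fg_mul1g fg_mulg1 fg_mulVg fg_mulgV.

End FreeGroup.

Record digraph := Digraph {
  vertex : Type;
  edge : Type;
  esrc : edge -> vertex;
  erng : edge -> vertex
}.

HB.instance Definition _ (G : digraph) := gen_eqMixin (vertex G).
HB.instance Definition _ (G : digraph) := gen_choiceMixin (vertex G).
HB.instance Definition _ (G : digraph) := gen_eqMixin (edge G).
HB.instance Definition _ (G : digraph) := gen_choiceMixin (edge G).

Record sepgraph := Sepgraph {
  graph :> digraph;
  blocks : vertex graph -> set (set (edge graph));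
  blocksP : forall v,
    partition (blocks v) id [set e : edge graph | esrc e = v]
}.

Definition in_blocks (G : sepgraph) (X : set (edge G)) : Prop :=
  exists v, blocks v X.

Section Paths.
Variable G : sepgraph.

Definition hedge : Type := (edge G + edge G)%type.
HB.instance Definition _ := Choice.on hedge.

Definition hsrc (x : hedge) : vertex G :=
  match x with inl e => esrc e | inr e => erng e end.
Definition hrng (x : hedge) : vertex G :=
  match x with inl e => erng e | inr e => esrc e end.

(* The pair [(v, w)] stands for the path with source [v] and letters [w]; it
   is the vertex [v] when [w] is empty.  Only pairs satisfying [is_path]
   are paths. *)
Definition gpath : Type := (vertex G * seq hedge)%type.
HB.instance Definition _ := Choice.on gpath.

Definition psrc (p : gpath) : vertex G := p.1.
Definition prng (p : gpath) : vertex G := last p.1 (map hrng p.2).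

Fixpoint path_from (v : vertex G) (w : seq hedge) : bool :=
  if w is x :: w' then (hsrc x == v) && path_from (hrng x) w' else true.

Definition is_path (p : gpath) : bool := path_from p.1 p.2.

(* The groupoid operations on reduced paths; [pathM p q] is meaningful only if
   [prng p = psrc q]. *)
Definition pathM (p q : gpath) : gpath := (p.1, red (p.2 ++ q.2)).
Definition pathV (p : gpath) : gpath := (prng p, winv p.2).
Definition vpath (v : vertex G) : gpath := (v, [::]).

Definition omega (p : gpath) : free_group (edge G) := fg_word p.2.

Definition le_pref (p q : gpath) : bool := (p.1 == q.1) && prefix p.2 q.2.

Definition prefixes (p : gpath) : seq gpath :=
  [seq (p.1, take i p.2) | i <- iota 0 (size p.2).+1].

Definition pref_down (A : {fset gpath}) : {fset gpath} :=
  [fset q | q in flatten [seq prefixes p | p <- A]]%fset.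

Lemma prefixesP p q : (q \in prefixes p) = le_pref q p.
Proof.
apply/mapP/andP => [[i _ ->]|]; first by rewrite /= eqxx prefix_take.
case: p q => [v w] [v' w'] /= [/eqP ->]; rewrite prefixE => /eqP ww'.
exists (size w'); last by rewrite ww'.
by rewrite -[0 :: _]/(iota 0 (size w).+1) mem_iota ltnS -ww' size_take_min geq_minr.
Qed.

Lemma pref_downP (A : {fset gpath}) q :
  reflect (exists2 p, p \in A & le_pref q p) (q \in pref_down A).
Proof.
rewrite !inE; apply: (iffP flatten_mapP) => -[p pA qp]; exists p => //.
  by rewrite -prefixesP.
by rewrite prefixesP.
Qed.

Definition lower (A : {fset gpath}) : Prop :=
  forall p q, q \in A -> le_pref p q -> p \in A.

Definition pref_maximal (A : {fset gpath}) (p : gpath) : Prop :=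
  p \in A /\ forall q, q \in A -> le_pref p q -> q = p.

Definition Cturn (x y : hedge) : bool :=
  match x, y with
  | inr e, inl f => `[< exists X, [/\ in_blocks X, X e & X f] >]
  | _, _ => false
  end.

Definition Cseparated (w : seq hedge) : bool := sorted (fun x y => ~~ Cturn x y) w.

Definition FC (p : gpath) : bool :=
  [&& is_path p, reduced p.2 & Cseparated p.2].

Definition FC_at (v : vertex G) (p : gpath) : Prop := FC p /\ psrc p = v.

(* Being a subset of [FC_at v] is part of the definition. *)
Definition Ccompatible (v : vertex G) (A : {fset gpath}) : Prop :=
  (forall p, p \in A -> FC_at v p) /\
  (forall p q, p \in A -> q \in A -> FC (pathM (pathV q) p)).

Definition X_at (v : vertex G) (T : {fset gpath}) : Prop :=
  [/\ T <> fset0, lower T & Ccompatible v T].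

Definition is_tree (T : {fset gpath}) : bool := `[< exists v, X_at v T >].

(* [None] is the zero element. *)
Definition Xsl : Type := option {T : {fset gpath} | is_tree T}.
HB.instance Definition _ := Choice.on Xsl.

(* [toX T] is [T] seen as an element of [Xsl]; it is zero if [T] is not a
   tree. *)
Definition toX (T : {fset gpath}) : Xsl := insub T.

Definition Xmul (x y : Xsl) : Xsl :=
  match x, y with
  | Some T1, Some T2 =>
      if `[< exists v, [/\ X_at v (val T1), X_at v (val T2)
                         & Ccompatible v (val T1 `|` val T2)%fset] >]
      then toX (val T1 `|` val T2)%fset else None
  | _, _ => None
  end.

HB.instance Definition _ := hasMul.Build Xsl Xmul.
HB.instance Definition _ := hasNull.Build Xsl None.

Definition Lletter (x : hedge) : bool :=
  match x with inl e => `[< in_blocks [set e]%classic >] | inr _ => true end.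

Definition X_L (v : vertex G) (T : {fset gpath}) : Prop :=
  X_at v T /\
  forall p w x, pref_maximal T p -> p.2 = rcons w x -> ~~ Lletter x.

(* Removes the longest suffix consisting of letters satisfying [Lletter]. *)
Definition strip (w : seq hedge) : seq hedge :=
  foldr (fun x w' => if (w' == [::]) && Lletter x then [::] else x :: w') [::] w.

Definition pL (p : gpath) : gpath := (p.1, strip p.2).

Definition TL (T : {fset gpath}) : {fset gpath} :=
  pref_down [fset pL p | p in T]%fset.

Lemma stripP (w : seq hedge) : exists w',
  [/\ w = strip w ++ w', all Lletter w'
    & strip w = [::] \/ exists u e, strip w = rcons u (inl e) /\
        exists X, [/\ in_blocks X, X e & exists2 f, X f & f <> e]].
Proof.
elim: w => [|x w [w' [ww' Lw' IH]]]; first by exists [::]; split => //; left.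
rewrite /=; have [wnil|wnnil] := eqVneq (strip w) [::]; last first.
  exists w'; split => //=; first by rewrite -ww'.
  case: IH => [/eqP|[u [e [-> X]]]]; first by rewrite (negPf wnnil).
  by right; exists (x :: u), e.
have [Lx|Lx] /= := boolP (Lletter x).
  by exists (x :: w'); split; [rewrite ww' wnil|rewrite /= Lx|left].
exists w'; rewrite wnil; split => //; first by rewrite /= {1}ww' wnil.
right; case: x Lx => [e|//] /asboolPn neC; exists [::], e; split => //.
have [+ _ _] := blocksP (esrc e).
move=> /seteqP[_ /(_ e erefl)] [X CX Xe].
have CX' : in_blocks X by exists (esrc e).
exists X; split => //; apply: contrapT => nf; apply: neC.
suff <- : X = [set e]%classic by [].
apply/seteqP; split => [f Xf /=|f -> //].
by apply: contrapT => fe; apply: nf; exists f.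
Qed.

Inductive simL : Xsl -> Xsl -> Prop :=
| simL_inverse v w e : FC (v, rcons w (inr e)) ->
    simL (toX (pref_down [fset (v, rcons w (inr e))]%fset))
         (toX (pref_down [fset (v, w)]%fset))
| simL_edge v w e : in_blocks [set e]%classic -> FC (v, rcons w (inl e)) ->
    simL (toX (pref_down [fset (v, rcons w (inl e))]%fset))
         (toX (pref_down [fset (v, w)]%fset))
| simL_refl x : simL x x
| simL_sym x y : simL x y -> simL y x
| simL_trans x y z : simL x y -> simL y z -> simL x z
| simL_mull x y z : simL x y -> simL (z * x) (z * y)
| simL_mulr x y z : simL x y -> simL (x * z) (y * z).

Definition simLb (x y : Xsl) : bool := `[< simL x y >].

Lemma simLb_refl : reflexive simLb.
Proof. by move=> x; apply/asboolP/simL_refl. Qed.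
Lemma simLb_sym : symmetric simLb.
Proof. by move=> x y; apply/asboolP/asboolP => /simL_sym. Qed.
Lemma simLb_trans : transitive simLb.
Proof.
by move=> y x z /asboolP xy /asboolP yz; apply/asboolP/(simL_trans xy yz).
Qed.

Canonical simL_equiv := EquivRel simLb simLb_refl simLb_sym simLb_trans.

Definition Y_L : Type := {eq_quot simL_equiv}.
HB.instance Definition _ := Choice.on Y_L.

Definition toY (x : Xsl) : Y_L := \pi_({eq_quot simL_equiv}) x.

Definition Ymul (a b : Y_L) : Y_L := toY (repr a * repr b).

HB.instance Definition _ := hasMul.Build Y_L Ymul.
HB.instance Definition _ := hasNull.Build Y_L (toY null).

Lemma toY_eq x y : toY x = toY y <-> simL x y.
Proof.
split; first by move/eqP; rewrite /toY piE => /asboolP.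
by move=> xy; apply/eqP; rewrite /toY piE; apply/asboolP.
Qed.

Lemma toY_morph : morphism0 toY.
Proof.
split=> // x y; apply/toY_eq; have [ex ey] : simL x (repr (toY x)) /\ simL y (repr (toY y)).
  by split; apply/toY_eq; rewrite /toY reprK.
exact: simL_trans (simL_mulr _ ex) (simL_mull _ ey).
Qed.

Definition Yclass (T : {fset gpath}) : Y_L := toY (toX T).

Definition representative (T T' : {fset gpath}) : Prop :=
  is_tree T' /\ simL (toX T') (toX T).

Definition is_LM (t : {fset gpath} * gpath) : bool :=
  `[< [/\ exists v, X_L v t.1, FC t.2 & pL t.2 \in t.1] >].

(* [None] is the zero element. *)
Definition LM : Type := option {t : {fset gpath} * gpath | is_LM t}.

Definition translate (g : gpath) (T : {fset gpath}) : {fset gpath} :=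
  [fset pathM g h | h in T]%fset.

(* The product, computed with the representatives [T1] and [T2]; [None] is
   zero. *)
Definition LM_prod (T1 : {fset gpath}) (g1 : gpath) (T2 : {fset gpath})
    (g2 : gpath) : option ({fset gpath} * gpath) :=
  let U := (T1 `|` translate g1 T2)%fset in
  if `[< prng g1 = psrc g2 /\ exists v, Ccompatible v U >]
  then Some (TL U, pathM g1 g2) else None.

(* A particular representative of [T] containing [g]. *)
Definition saturate (T : {fset gpath}) (g : gpath) : {fset gpath} :=
  (T `|` pref_down [fset g])%fset.

Definition LM_mul (x y : LM) : LM :=
  match x, y with
  | Some t1, Some t2 =>
      let: (T1, g1) := val t1 in let: (T2, g2) := val t2 in
      obind insub (LM_prod (saturate T1 g1) g1 (saturate T2 g2) g2)
  | _, _ => None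
  end.

HB.instance Definition _ := hasMul.Build LM LM_mul.
HB.instance Definition _ := hasNull.Build LM None.

(* [toLM t] is zero if [t] is not a Leavitt-Munn tree. *)
Definition toLM (t : {fset gpath} * gpath) : LM := insub t.
Definition LM_val (x : LM) : option ({fset gpath} * gpath) := omap val x.

Definition LM_omega (x : LM) : free_group (edge G) :=
  if x is Some t then omega (val t).2 else 1.

End Paths.

Section LeavittInverseSemigroup.
Variable G : sepgraph.

Definition LI_gen : Type := (vertex G + hedge G)%type.

Inductive LI_term : Type :=
| tgen of LI_gen
| tzero
| tmul of LI_term & LI_term
| tinv of LI_term.

HB.instance Definition _ := gen_eqMixin LI_term.
HB.instance Definition _ := gen_choiceMixin LI_term.

Definition tv (v : vertex G) : LI_term := tgen (inl v).
Definition tx (x : hedge G) : LI_term := tgen (inr x).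

Inductive LI_relator : LI_term -> LI_term -> Prop :=
| LI_rel1 v w : LI_relator (tmul (tv v) (tv w)) (if v == w then tv v else tzero)
| LI_rel2 x : LI_relator (tmul (tv (hsrc x)) (tx x)) (tx x)
| LI_rel3 x : LI_relator (tmul (tx x) (tv (hrng x))) (tx x)
| LI_rel4 X e f : in_blocks X -> X e -> X f ->
    LI_relator (tmul (tx (inr e)) (tx (inl f)))
               (if e == f then tv (erng e) else tzero)
| LI_rel5 e : in_blocks [set e]%classic ->
    LI_relator (tmul (tx (inl e)) (tx (inr e))) (tv (esrc e)).

(* The congruence generated by the relators, the axioms of a zero element and
   the equational axioms of inverse semigroups. *)
Inductive LI_cong : LI_term -> LI_term -> Prop :=
| LI_rel t u : LI_relator t u -> LI_cong t u
| LI_assoc t u s : LI_cong (tmul t (tmul u s)) (tmul (tmul t u) s)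
| LI_zerol t : LI_cong (tmul tzero t) tzero
| LI_zeror t : LI_cong (tmul t tzero) tzero
| LI_invK t : LI_cong (tinv (tinv t)) t
| LI_mulV t : LI_cong (tmul (tmul t (tinv t)) t) t
| LI_comm t u : LI_cong (tmul (tmul t (tinv t)) (tmul u (tinv u)))
                        (tmul (tmul u (tinv u)) (tmul t (tinv t)))
| LI_refl t : LI_cong t t
| LI_sym t u : LI_cong t u -> LI_cong u t
| LI_trans t u s : LI_cong t u -> LI_cong u s -> LI_cong t s
| LI_mul t t' u u' : LI_cong t t' -> LI_cong u u' ->
    LI_cong (tmul t u) (tmul t' u')
| LI_inv t t' : LI_cong t t' -> LI_cong (tinv t) (tinv t').

Definition LI_congb (t u : LI_term) : bool := `[< LI_cong t u >].

Lemma LI_congb_refl : reflexive LI_congb.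
Proof. by move=> x; apply/asboolP/LI_refl. Qed.
Lemma LI_congb_sym : symmetric LI_congb.
Proof. by move=> x y; apply/asboolP/asboolP => /LI_sym. Qed.
Lemma LI_congb_trans : transitive LI_congb.
Proof.
by move=> y x z /asboolP xy /asboolP yz; apply/asboolP/(LI_trans xy yz).
Qed.

Canonical LI_equiv := EquivRel LI_congb LI_congb_refl LI_congb_sym LI_congb_trans.

Definition LI : Type := {eq_quot LI_equiv}.
HB.instance Definition _ := Choice.on LI.

Definition toLI (t : LI_term) : LI := \pi_({eq_quot LI_equiv}) t.

HB.instance Definition _ :=
  hasMul.Build LI (fun a b => toLI (tmul (repr a) (repr b))).
HB.instance Definition _ := hasNull.Build LI (toLI tzero).

Definition LI_of (a : LI_gen) : LI := toLI (tgen a).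

Lemma toLI_eq t u : toLI t = toLI u <-> LI_cong t u.
Proof.
split; first by move/eqP; rewrite /toLI piE => /asboolP.
by move=> xy; apply/eqP; rewrite /toLI piE; apply/asboolP.
Qed.

Lemma repr_toLI t : LI_cong (repr (toLI t)) t.
Proof. by apply/toLI_eq; rewrite /toLI reprK. Qed.

Lemma toLI_repr a : toLI (repr a) = a.
Proof. exact: reprK. Qed.

Lemma toLI_mul t u : toLI (tmul t u) = toLI t * toLI u.
Proof. by apply/toLI_eq/LI_sym/LI_mul; apply: repr_toLI. Qed.

Lemma LI_ind_term (P : LI -> Prop) : (forall t, P (toLI t)) -> forall a, P a.
Proof. by move=> H a; rewrite -(toLI_repr a). Qed.

Lemma LI_semigroup0 : semigroup0 LI.
Proof.
split=> [a b c|a|a]; elim/LI_ind_term: a => t.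
- elim/LI_ind_term: b => u; elim/LI_ind_term: c => s.
  rewrite -(toLI_mul u s) -(toLI_mul t u) -(toLI_mul t) -(toLI_mul _ s).
  exact/toLI_eq/LI_assoc.
- by rewrite -[null]/(toLI tzero) -(toLI_mul tzero t); apply/toLI_eq/LI_zerol.
- by rewrite -[null]/(toLI tzero) -(toLI_mul t tzero); apply/toLI_eq/LI_zeror.
Qed.

Definition LI_invf (s : LI) : LI := toLI (tinv (repr s)).

Lemma toLI_inv t : LI_invf (toLI t) = toLI (tinv t).
Proof. exact/toLI_eq/LI_inv/repr_toLI. Qed.

Lemma LI_invfK : involutive LI_invf.
Proof.
by elim/LI_ind_term=> t; rewrite !toLI_inv; apply/toLI_eq/LI_invK.
Qed.

Lemma LI_mulVf s : s * LI_invf s * s = s.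
Proof.
elim/LI_ind_term: s => t; rewrite toLI_inv -(toLI_mul t) -(toLI_mul _ t).
exact/toLI_eq/LI_mulV.
Qed.

Lemma LI_commf s t : s * LI_invf s * (t * LI_invf t) = t * LI_invf t * (s * LI_invf s).
Proof.
elim/LI_ind_term: s => s; elim/LI_ind_term: t => t; rewrite !toLI_inv.
rewrite -(toLI_mul t) -(toLI_mul s) -(toLI_mul (tmul t _)) -(toLI_mul (tmul s _)).
exact/toLI_eq/LI_comm.
Qed.

Lemma LI_inverse_semigroup0 : inverse_semigroup0 LI.
Proof.
have [A _ _] := LI_semigroup0; split; first exact: LI_semigroup0.
have iVi s : LI_invf s * s * LI_invf s = LI_invf s.
  by rewrite -{2}(LI_invfK s) LI_mulVf.
have idE (e : LI) : e * e = e -> e * LI_invf e = e.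
  move=> ee; have c := LI_commf e (LI_invf e); rewrite LI_invfK in c.
  set f := LI_invf e in c *; have fef : f * e * f = f by apply: iVi.
  have fE : e * (f * (f * e)) = f.
    by rewrite !A -(A (e * f)) c !A -(A f e e) ee fef.
  have l : e * f = f by rewrite -{1}fE (A e e) ee fE.
  have r : f * e = f by rewrite -{1}fE -!A ee fE.
  by rewrite l -[RHS]LI_mulVf -/f l r.
have icomm (e f : LI) : e * e = e -> f * f = f -> e * f = f * e.
  by move=> /idE <- /idE <-; apply: LI_commf.
move=> s; exists (LI_invf s); split; first by split; [apply: LI_mulVf|].
move=> t [st ts]; set i := LI_invf s.
have is1 : i * s * i = i by apply: iVi.
have is2 : s * i * s = s by apply: LI_mulVf.
have e1 : s * t * (s * t) = s * t by rewrite A st.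
have e2 : s * i * (s * i) = s * i by rewrite A is2.
have e3 : t * s * (t * s) = t * s by rewrite A ts.
have e4 : i * s * (i * s) = i * s by rewrite A is1.
have h1 : s * i = s * t.
  by rewrite -{1}st -(A (s * t)) (icomm _ _ e1 e2) A is2.
have h2 : i * s = t * s.
  by rewrite -{1}st -(A s t s) (A i) (icomm _ _ e4 e3) -(A t) (A s) is2.
by rewrite -is1 h2 -A h1 A ts.
Qed.

(* The elements [LI_of a] satisfy the defining relations, and [LI] is universal
   among the inverse semigroups with zero generated by such elements. *)
Record LI_family (S : magma0Type) (phi : LI_gen -> S) : Prop := LIFamily {
  LI_fam1 : forall v w,
    phi (inl v) * phi (inl w) = if v == w then phi (inl v) else null;
  LI_fam2 : forall x, phi (inl (hsrc x)) * phi (inr x) = phi (inr x);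
  LI_fam3 : forall x, phi (inr x) * phi (inl (hrng x)) = phi (inr x);
  LI_fam4 : forall X e f, in_blocks X -> X e -> X f ->
    phi (inr (inr e)) * phi (inr (inl f)) =
    if e == f then phi (inl (erng e)) else null;
  LI_fam5 : forall e, in_blocks [set e]%classic ->
    phi (inr (inl e)) * phi (inr (inr e)) = phi (inl (esrc e))
}.

Lemma LI_of_family : LI_family LI_of.
Proof.
split=> [v w|x|x|X e f CX Xe Xf|e Ce]; rewrite /LI_of -(toLI_mul (tgen _) (tgen _)).
- have := LI_rel (LI_rel1 v w); by case: eqP => _ /toLI_eq.
- exact/toLI_eq/LI_rel/LI_rel2.
- exact/toLI_eq/LI_rel/LI_rel3.
- have := LI_rel (LI_rel4 CX Xe Xf); by case: eqP => _ /toLI_eq.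
- exact/toLI_eq/LI_rel/LI_rel5.
Qed.

End LeavittInverseSemigroup.

Lemma idempotents_commute (S : magma0Type) : inverse_semigroup0 S ->
  forall e f : S, e * e = e -> f * f = f -> e * f = f * e.
Proof.
move=> [[A _ _] U].
have uq (s t t' : S) : is_inverse s t -> is_inverse s t' -> t = t'.
  by have [u [_ uu]] := U s => a b; rewrite -(uu _ a) -(uu _ b).
have idem (e f : S) : e * e = e -> f * f = f -> e * f * (e * f) = e * f.
  move=> ee ff; have [x [[x1 x2] _]] := U (e * f).
  have eK y : e * (e * y) = e * y by rewrite A ee.
  have fK y : f * (f * y) = f * y by rewrite A ff.
  have x2K y : x * (e * (f * (x * y))) = x * y.
    by rewrite !A -(A x e f) x2.
  have xE : f * (x * e) = x.
    apply: (uq (e * f)); split => //.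
      by rewrite -!A fK eK; rewrite -!A in x1.
    by rewrite -!A eK fK x2K.
  have xx : x * x = x by rewrite -{1 2}xE -!A x2K xE.
  suff <- : x = e * f by [].
  by apply: (uq x); split; rewrite ?xx.
move=> e f ee ff; have ef := idem _ _ ee ff; have fe := idem _ _ ff ee.
have eK y : e * (e * y) = e * y by rewrite A ee.
have fK y : f * (f * y) = f * y by rewrite A ff.
rewrite -!A in ef fe; apply: (uq (e * f)); split.
- by rewrite -!A ef ef.
- by rewrite -!A ef ef.
- by rewrite -!A fK eK ef.
- by rewrite -!A eK fK fe.
Qed.

Lemma LI_universal (G : sepgraph) (S : magma0Type) (phi : LI_gen G -> S) :
  inverse_semigroup0 S -> LI_family phi ->
  exists! f : LI G -> S, morphism0 f /\ forall a, f (LI_of a) = phi a.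
Proof.
move=> IS fam; have [[A zl zr] U] := IS.
have [i iP] : {i : S -> S & forall s, is_inverse s (i s)}.
  by apply: (@choice _ _ (@is_inverse S)) => s; have [t [tP _]] := U s; exists t.
have uq (s t t' : S) : is_inverse s t -> is_inverse s t' -> t = t'.
  by have [u [_ uu]] := U s => a b; rewrite -(uu _ a) -(uu _ b).
have idV s : s * i s * (s * i s) = s * i s by rewrite A (iP s).1.
pose ev := fix ev (t : LI_term G) : S := match t with
  | tgen a => phi a | tzero => null
  | tmul t u => ev t * ev u | tinv t => i (ev t) end.
have evP t u : LI_cong t u -> ev t = ev u.
  elim=> {t u} //=.
  - move=> t u [] //=.
    + by move=> v w; rewrite (LI_fam1 fam); case: eqP.
    + exact: LI_fam2 fam.
    + exact: LI_fam3 fam.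
    + by move=> X e f CX Xe Xf; rewrite (LI_fam4 fam CX Xe Xf); case: eqP.
    + exact: LI_fam5 fam.
  - move=> t; apply: (uq (i (ev t))); first exact: iP.
    by have [? ?] := iP (ev t); split.
  - by move=> t; have [] := iP (ev t).
  - by move=> t u; apply: idempotents_commute.
  - by move=> t u s _ -> _ ->.
  - by move=> t t' u u' _ -> _ ->.
  - by move=> t t' _ ->.
have evr t : ev (repr (toLI t)) = ev t by apply: evP; apply: repr_toLI.
exists (fun x => ev (repr x)); split.
  split; last by move=> a; rewrite /LI_of evr.
  by split=> [x y|]; rewrite evr.
move=> f [[fM f0] fa]; apply/funext => x; rewrite -[in RHS](toLI_repr x).
have fV t : f (toLI (tinv t)) = i (f (toLI t)).
  have V1 u : f (toLI u) * f (toLI (tinv u)) * f (toLI u) = f (toLI u).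
    by rewrite -!fM -toLI_inv LI_mulVf.
  apply: (uq (f (toLI t))); last exact: iP.
  split; first exact: V1.
  by have := V1 (tinv t); rewrite -!toLI_inv LI_invfK.
apply/esym; elim: (repr x) => [a||t IHt u IHu|t IHt] /=.
- exact: fa.
- exact: f0.
- by rewrite toLI_mul fM IHt IHu.
- by rewrite fV IHt.
Qed.

(* Main.v *)
Require Import Defs.
From HB Require Import structures.
From mathcomp Require Import all_boot.
From mathcomp Require Import finmap.
From mathcomp Require Import mathcomp_extra boolp classical_sets functions.

Set Implicit Arguments.
Unset Strict Implicit.
Unset Printing Implicit Defensive.

Local Open Scope group_scope.

(* On prefix-closed sets, C-compatibility means that there are no forks: never
   both [p.e] and [p.f] with [e <> f] in a common block. This condition is
   invariant under translation in the fundamental groupoid. A tree [T] is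
   replaced by its saturation [sat T], the set of all [t.w] with [t] in [T] and
   [w] a path of letters [e^-1] or [e] with [{e}] in C. Saturation commutes with
   unions and translations, does not create forks, and two trees are equivalent
   for [simL] iff their saturations agree. Hence a Leavitt-Munn tree is a pair
   [(A, g)] of a fork-free saturation and some [g] in [A], with product
   [(A u g.B, g.h)], for which associativity and the inverse semigroup axioms
   are immediate.
   The universal property gives LI -> LM. For injectivity, every nonzero
   element of LI is [prod_(p in T) p p^-1 * g] with [g] in the tree [T], by
   [x (p p^-1) = (x.p)(x.p)^-1 x]; such an element vanishes when [T] has a fork,
   depends only on [sat T], and is sent to [(sat T, g)]. *)

(** * Reduced words and the fundamental groupoid *)

(** The trees of [X_L] are awkward to multiply directly: a translate of a stripped tree need not be
    prefix-closed, since the path that would bring it back to the root may have been stripped away.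
    This is why the product is stated with representatives. The saturation is the union of all
    representatives of a class, so no choice remains, and it contains [g] exactly when the tree
    contains [g_L]. In LI the normal form has to be established for arbitrary reduced paths:
    multiplying by a letter may produce paths that are not C-separated and trees with forks. These
    are discarded only at the end, because the corresponding products vanish. The same dichotomy
    shows that no nonzero element of LI is sent to zero: a product of ranges either has a fork, and
    is already zero in LI, or comes from a genuine tree, and its image can be computed. *)

Section ReducedWords.
Variable X : choiceType.
Implicit Types (a b w u : seq (X + X)) (x y : X + X).

Lemma linv_eq x y : (x == linv y) = (y == linv x).
Proof. by apply/eqP/eqP => ->; rewrite linvK. Qed.

Lemma reduced_catl a b : reduced (a ++ b) -> reduced a.
Proof. by rewrite /reduced; case: a => //= x a; rewrite cat_path => /andP[]. Qed.

Lemma reduced_catr a b : reduced (a ++ b) -> reduced b.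
Proof.
rewrite /reduced; case: a => //= x a; rewrite cat_path => /andP[_].
exact: path_sorted.
Qed.

Lemma reduced_prefix a b : prefix a b -> reduced b -> reduced a.
Proof. by move/prefixP => [c ->]; apply: reduced_catl. Qed.

Lemma winv_cat a b : winv (a ++ b) = winv b ++ winv a.
Proof. by rewrite /winv map_cat rev_cat. Qed.

Lemma winv_cons x a : winv (x :: a) = rcons (winv a) (linv x).
Proof. by rewrite /winv map_cons rev_cons. Qed.

Lemma reduced_winv a : reduced a -> reduced (winv a).
Proof.
rewrite /reduced /winv rev_sorted sorted_map; apply: sub_sorted => x y /=.
by rewrite linvK; apply: contra => /eqP ->.
Qed.

Lemma red_rcons_red w x : red (rcons (red w) x) = red (rcons w x).
Proof. by rewrite -cats1 red_catl cats1. Qed.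

(** Reduced words are the points of a tree, and a letter moves to a neighbour: one letter back or
    one letter forward. This drives the inductions from the right end of a word. *)
Lemma red_rcons w x : reduced w ->
  (exists w', w = rcons w' (linv x) /\ red (rcons w x) = w') \/
  red (rcons w x) = rcons w x.
Proof.
case: (lastP w) => [|w' y] rw; first by right.
have [->|yx] := eqVneq y (linv x).
  left; exists w'; split=> //.
  rewrite -!cats1 -catA -red_catr /= linvK eqxx cats0 red_id //.
  by move: rw; rewrite -cats1; apply: reduced_catl.
right; apply: red_id; move: rw; rewrite /reduced.
case: w' => [|z w'] /=; first by rewrite andbT -linv_eq.
by rewrite !rcons_path last_rcons => ->; rewrite -linv_eq.
Qed.

Lemma prefix_rcons_inv u w x : prefix u (rcons w x) -> prefix u w \/ u = rcons w x.
Proof.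
move/prefixP => [c]; case: (lastP c) => [|c' y]; first by rewrite cats0 => ->; right.
rewrite -rcons_cat => /rcons_inj[-> _]; left; exact: prefix_prefix.
Qed.

(** Reading [b] letter by letter is a walk in the Cayley tree starting at [a]. A point between the
    root and its end is visited by the walk or is a prefix of [a]. *)
Lemma prefix_red a b u : reduced a -> prefix u (red (a ++ b)) ->
  prefix u a \/ exists2 b', prefix b' b & u = red (a ++ b').
Proof.
move=> ra; elim/last_ind: b => [|b x IH].
  by rewrite cats0 red_id //; left.
have IH' : prefix u (red (a ++ b)) ->
    prefix u a \/ exists2 b', prefix b' (rcons b x) & u = red (a ++ b').
  case/IH => [|[b' b'b ->]]; [by left|right; exists b' => //].
  exact: prefix_trans b'b (prefix_rcons _ _).
rewrite -rcons_cat -red_rcons_red => ux.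
have [[w' [ww' rE]]|rE] := red_rcons x (red_reduced (a ++ b)).
  apply: IH'; rewrite ww'; apply: prefix_trans (prefix_rcons _ _).
  by rewrite -rE.
move: ux; rewrite rE => /prefix_rcons_inv [//|->]; right; exists (rcons b x).
  exact: prefix_refl.
by rewrite -rE red_rcons_red rcons_cat.
Qed.

Lemma fg_wordM a b : fg_word (a ++ b) = fg_word a * fg_word b.
Proof. by apply: val_inj; rewrite /= red_catl red_catr. Qed.

Lemma red_winvr w : red (w ++ winv w) = [::].
Proof. by rewrite -{1}(winvK w) red_winvl. Qed.

Lemma fg_wordV a : fg_word (winv a) = (fg_word a)^-1.
Proof.
apply: (@mulgI _ (fg_word a)); rewrite mulgV -fg_wordM; apply: val_inj => /=.
exact: red_winvr.
Qed.

Lemma fg_word_red a : fg_word (red a) = fg_word a.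
Proof. by apply: val_inj; rewrite /= red_id ?red_reduced. Qed.

Lemma red_winv a : red (winv a) = winv (red a).
Proof.
rewrite -[RHS]red_id ?reduced_winv ?red_reduced //.
by have := congr1 val (fg_wordV (red a)); rewrite fg_word_red -fg_wordV /= => <-.
Qed.

Lemma fg_word_inj a b : reduced a -> reduced b -> fg_word a = fg_word b -> a = b.
Proof. by move=> /red_id {2}<- /red_id {2}<- /(congr1 val). Qed.

End ReducedWords.

Section Groupoid.
Variable G : sepgraph.
Local Notation gp := (gpath G).
Implicit Types (p q r g : gp) (v : vertex G) (w a b : seq (hedge G)) (x : hedge G).

Definition pend v w : vertex G := last v (map (@hrng G) w).

Lemma prngE p : prng p = pend p.1 p.2. Proof. by []. Qed.

Lemma pend_cat v a b : pend v (a ++ b) = pend (pend v a) b.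
Proof. by rewrite /pend map_cat last_cat. Qed.

Lemma path_from_cat v a b :
  path_from v (a ++ b) = path_from v a && path_from (pend v a) b.
Proof. by elim: a v => //= x a IH v; rewrite IH andbA. Qed.

Lemma path_from_rcons v w x :
  path_from v (rcons w x) = path_from v w && (hsrc x == pend v w).
Proof. by rewrite -cats1 path_from_cat /= andbT. Qed.

Lemma hsrc_linv x : hsrc (linv x) = hrng x. Proof. by case: x. Qed.
Lemma hrng_linv x : hrng (linv x) = hsrc x. Proof. by case: x. Qed.

Lemma path_red v w : path_from v w ->
  path_from v (red w) /\ pend v (red w) = pend v w.
Proof.
elim: w v => //= x w IH v /andP[/eqP xv /IH[]].
rewrite /push; case: (red w) => [|b w'] /=; first by rewrite xv eqxx.
case: (b =P linv x) => [->|_] /=; last by rewrite xv eqxx.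
by rewrite hsrc_linv eqxx /= {1}/pend /= hrng_linv xv.
Qed.

Lemma path_winv v w : path_from v w ->
  path_from (pend v w) (winv w) /\ pend (pend v w) (winv w) = v.
Proof.
elim: w v => //= x w IH v /andP[/eqP xv /IH[]].
rewrite winv_cons -[pend v (x :: w)]/(pend (hrng x) w) path_from_rcons => -> e.
by rewrite hsrc_linv e eqxx -cats1 pend_cat e /pend /= hrng_linv.
Qed.

(** Elements of the fundamental groupoid. C-separation is left out because products and translations
    do not preserve it; it is recovered from fork-freeness. *)
Definition rpath p : bool := is_path p && reduced p.2.

Lemma rpath_vpath v : rpath (vpath v). Proof. by []. Qed.

Lemma pathMA p q r : pathM p (pathM q r) = pathM (pathM p q) r.
Proof. by rewrite /pathM /= red_catr red_catl catA. Qed.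

Lemma pathM_rpath p q : rpath p -> rpath q -> prng p = psrc q ->
  rpath (pathM p q) /\ prng (pathM p q) = prng q.
Proof.
move=> /andP[pp _] /andP[pq _] pqE.
have pc : path_from p.1 (p.2 ++ q.2) by rewrite path_from_cat [path_from p.1 _]pp -prngE pqE.
have [h1 h2] := path_red pc; split; first by rewrite /rpath /is_path h1 /= red_reduced.
by rewrite prngE h2 pend_cat -prngE pqE.
Qed.

Lemma pathV_rpath p : rpath p -> rpath (pathV p) /\ prng (pathV p) = psrc p.
Proof.
move=> /andP[pp rp]; have [h1 h2] := path_winv pp.
by rewrite /rpath /is_path h1 reduced_winv.
Qed.

Lemma pathVK p : rpath p -> pathV (pathV p) = p.
Proof.
move=> /pathV_rpath[_ pV]; rewrite -[LHS]/(prng (pathV p), winv (winv p.2)).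
by rewrite pV winvK -surjective_pairing.
Qed.

Lemma pathVM p q : rpath p -> rpath q -> prng p = psrc q ->
  pathV (pathM p q) = pathM (pathV q) (pathV p).
Proof.
move=> rp rq pq; rewrite {1}/pathV (pathM_rpath rp rq pq).2.
by rewrite /pathM /= -red_winv winv_cat.
Qed.

Lemma pathMV p : pathM p (pathV p) = vpath (psrc p).
Proof. by rewrite /pathM red_winvr. Qed.

Lemma pathVM1 p : pathM (pathV p) p = vpath (prng p).
Proof. by rewrite /pathM red_winvl. Qed.

Lemma pathM1 p v : rpath p -> pathM p (vpath v) = p.
Proof. by move=> /andP[_ rp]; rewrite /pathM cats0 red_id //; case: p rp. Qed.

Lemma path1M p v : rpath p -> psrc p = v -> pathM (vpath v) p = p.
Proof. by move=> /andP[_ rp] <-; rewrite /pathM /= red_id //; case: p rp. Qed.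

Lemma omegaM p q : omega (pathM p q) = omega p * omega q.
Proof. by rewrite /omega fg_word_red fg_wordM. Qed.

Lemma omegaV p : omega (pathV p) = (omega p)^-1.
Proof. exact: fg_wordV. Qed.

Lemma omega_vpath v : omega (vpath v) = 1.
Proof. exact: val_inj. Qed.

Lemma omega_inj p q : rpath p -> rpath q -> psrc p = psrc q -> omega p = omega q -> p = q.
Proof.
by case: p q => [v a] [v' b] /andP[_ ra] /andP[_ rb] /= -> /(fg_word_inj ra rb) /= ->.
Qed.

Lemma le_pref_refl p : le_pref p p.
Proof. by rewrite /le_pref eqxx prefix_refl. Qed.

Lemma le_pref_trans q p r : le_pref p q -> le_pref q r -> le_pref p r.
Proof.
move=> /andP[/eqP pq pq'] /andP[/eqP qr qr'].
by rewrite /le_pref pq qr eqxx (prefix_trans pq' qr').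
Qed.

Lemma rpath_prefix p q : le_pref p q -> rpath q -> rpath p.
Proof.
case: p q => [v a] [v' b] /andP[/= /eqP -> /prefixP[c /= ->]] /andP[].
rewrite /is_path /= path_from_cat => /andP[h _] /reduced_catl h'.
by rewrite /rpath /is_path /= h h'.
Qed.

(** Right multiplication by one letter, which steps back if [p] ends in the inverse of [x]. It
    commutes with left translation ([pstepM]), which is what makes forks translation invariant. *)
Definition pstep p x : gp := (p.1, red (rcons p.2 x)).

Lemma pstepM p q x : pathM p (pstep q x) = pstep (pathM p q) x.
Proof. by rewrite /pathM /pstep /= red_catr -[in RHS]cats1 red_catl cats1 rcons_cat. Qed.

Lemma pstep_red p x : pstep (p.1, red p.2) x = pstep p x.
Proof. by rewrite /pstep /= red_rcons_red. Qed.

(** * Finite prefix-closed sets of paths with a common source *)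

Definition rooted v (T : {fset gp}) : Prop :=
  [/\ T <> fset0, lower T & forall p, p \in T -> rpath p /\ psrc p = v].

Lemma lower_down (A : {fset gp}) : lower (pref_down A).
Proof.
move=> p q /pref_downP[r rA qr] pq; apply/pref_downP; exists r => //.
exact: le_pref_trans pq qr.
Qed.

Lemma sub_down (A : {fset gp}) p : p \in A -> p \in pref_down A.
Proof. by move=> pA; apply/pref_downP; exists p => //; apply: le_pref_refl. Qed.

Lemma down1P p q : (q \in pref_down [fset p]%fset) = le_pref q p.
Proof.
apply/pref_downP/idP => [[r]|qp]; first by rewrite inE => /eqP ->.
by exists p; rewrite ?inE.
Qed.

Lemma rooted_vpath v T : rooted v T -> vpath v \in T.
Proof.
move=> [/eqP/fset0Pn[p pT] low /(_ _ pT)[_ pv]].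
by apply: (low _ _ pT); rewrite /le_pref -pv /= eqxx prefix0s.
Qed.

Lemma rooted_down v (A : {fset gp}) : A <> fset0 ->
  (forall p, p \in A -> rpath p /\ psrc p = v) -> rooted v (pref_down A).
Proof.
move=> /eqP/fset0Pn[a aA] AP; split; [|exact: lower_down|].
  by apply/eqP/fset0Pn; exists a; apply: sub_down.
move=> p /pref_downP[q qA pq]; have [rq sq] := AP _ qA; split.
  exact: rpath_prefix pq rq.
by rewrite -sq; case/andP: pq => /eqP.
Qed.

Lemma rooted_down1 p : rpath p -> rooted (psrc p) (pref_down [fset p]%fset).
Proof.
move=> rp; apply: rooted_down => [|q].
  by apply/eqP/fset0Pn; exists p; rewrite inE.
by rewrite inE => /eqP ->.
Qed.

Lemma rootedU v T S : rooted v T -> rooted v S -> rooted v (T `|` S)%fset.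
Proof.
move=> [T0 lT TP] [_ lS SP]; split.
- apply/eqP/fset0Pn; have /eqP/fset0Pn[a aT] := T0.
  by exists a; rewrite inE aT.
- by move=> p q; rewrite !inE => /orP[qT|qS] pq; rewrite ?(lT _ _ qT pq) ?(lS _ _ qS pq) ?orbT.
- by move=> p; rewrite inE => /orP[/TP|/SP].
Qed.

Lemma translateP g T q :
  reflect (exists2 h, h \in T & q = pathM g h) (q \in translate g T).
Proof. by rewrite /translate; apply: imfsetP. Qed.

(* A prefix of [g . h] is either a prefix of [g], already in [T], or the
   translate of a prefix of [h]. *)
Lemma rooted_product v T g S : rooted v T -> g \in T -> rooted (prng g) S ->
  rooted v (T `|` translate g S)%fset.
Proof.
move=> [T0 lT TP] gT [S0 lS SP]; have [rg sg] := TP _ gT; split.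
- apply/eqP/fset0Pn; exists g; by rewrite inE gT.
- move=> p q; rewrite !inE => /orP[qT|/translateP[h hS ->]] pq.
    by rewrite (lT _ _ qT pq).
  case/andP: pq => /= /eqP p1 /prefix_red[||[b' b'h p2]].
  + by case/andP: rg.
  + by move=> pg; rewrite (lT p g) // /le_pref p1 eqxx.
  + apply/orP; right; apply/translateP; exists (h.1, b').
      by apply: (lS _ h) => //; rewrite /le_pref eqxx.
    by rewrite (surjective_pairing p) p1 p2.
- move=> p; rewrite inE => /orP[/TP//|/translateP[h hS ->]].
  have [rh sh] := SP _ hS; split=> //.
  by apply: (pathM_rpath rg rh _).1; rewrite sh.
Qed.

(** As [T] contains the prefixes of [g], its translate already contains the prefixes of [g^-1];
    adjoining them changes nothing, and [rooted_product] applies. *)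
Lemma rooted_translateV v T g : rooted v T -> g \in T ->
  rooted (prng g) (translate (pathV g) T).
Proof.
move=> rT gT; have [T0 lT TP] := rT; have [rg sg] := TP _ gT.
have [rV gV] := pathV_rpath rg.
have rdV : rooted (prng g) (pref_down [fset pathV g]%fset) by exact: (rooted_down1 rV).
have gVd : pathV g \in pref_down [fset pathV g]%fset by rewrite down1P le_pref_refl.
have rT' : rooted (prng (pathV g)) T by rewrite gV sg.
have := rooted_product rdV gVd rT'.
suff -> : (pref_down [fset pathV g] `|` translate (pathV g) T = translate (pathV g) T)%fset by [].
apply/fsetUidPr/fsubsetP => u; rewrite down1P => /andP[/eqP u1 /prefixP[z uz]].
(* If [g^-1 = u z], then [z^-1] is a prefix of [g] and [g^-1 . z^-1 = u]. *)
apply/translateP; exists (g.1, winv z).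
  apply: (lT _ _ gT); rewrite /le_pref eqxx /=.
  by rewrite -(winvK g.2) [winv g.2]uz winv_cat prefix_prefix.
rewrite /pathM /= (surjective_pairing u) u1 /= [winv g.2]uz -catA -red_catr red_winvr cats0 red_id //.
by move: rV => /andP[_ /=]; rewrite [winv g.2]uz => /reduced_catl.
Qed.

End Groupoid.

(** * Forks and saturation of trees *)

Section Saturation.
Variable G : sepgraph.
Local Notation gp := (gpath G).
Implicit Types (p q r g : gp) (v : vertex G) (w : seq (hedge G)) (x : hedge G).
Implicit Types (T S : {fset gp}) (A B : set gp).

Lemma block_src v (X : set (edge G)) e : blocks v X -> X e -> esrc e = v.
Proof.
by move=> vX Xe; have [/seteqP[h _] _ _] := blocksP v; apply: (h e); exists X.
Qed.

Lemma block_eq (X Y : set (edge G)) e :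
  in_blocks X -> in_blocks Y -> X e -> Y e -> X = Y.
Proof.
move=> [v vX] [v' vY] Xe Ye.
have vv : v = v' by rewrite -(block_src vX Xe) (block_src vY Ye).
rewrite -{}vv in vY; have [_ tr _] := blocksP v.
by apply: (tr X Y) => //; exists e.
Qed.

Lemma block_esrc (X : set (edge G)) e f : in_blocks X -> X e -> X f -> esrc e = esrc f.
Proof. by move=> [v vX] Xe Xf; rewrite (block_src vX Xe) (block_src vX Xf). Qed.

Lemma Lletter_block (X : set (edge G)) e f :
  in_blocks X -> X e -> X f -> Lletter (inl e : hedge G) -> e = f.
Proof.
by move=> CX Xe Xf /asboolP Ce; move: Xf; rewrite (block_eq CX Ce Xe erefl).
Qed.

(* Requiring [p] to lie in [A] would be equivalent on prefix-closed sets; an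
   arbitrary base point makes the condition translation invariant. *)
Definition fork_free A : Prop := forall p (X : set (edge G)) e f,
  in_blocks X -> X e -> X f -> A (pstep p (inl e)) -> A (pstep p (inl f)) -> e = f.

Lemma fork_free_sub A B : (A `<=` B)%classic -> fork_free B -> fork_free A.
Proof.
by move=> AB fB p X e f CX Xe Xf /AB Ae /AB Af; apply: fB CX Xe Xf Ae Af.
Qed.

Definition tr g A : set gp := [set pathM g p | p in A]%classic.

Lemma trM g h A : tr g (tr h A) = tr (pathM g h) A.
Proof. by rewrite /tr image_comp; apply: eq_imagel => p _ /=; rewrite pathMA. Qed.

Lemma trU g A B : tr g (A `|` B)%classic = (tr g A `|` tr g B)%classic.
Proof. exact: image_setU. Qed.

Lemma tr1 v A : (forall p, A p -> rpath p /\ psrc p = v) -> tr (vpath v) A = A.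
Proof.
move=> AP; apply/seteqP; split=> [_ [p Ap <-]|p Ap].
  by have [rp sp] := AP _ Ap; rewrite path1M.
by exists p => //; have [rp sp] := AP _ Ap; rewrite path1M.
Qed.

Lemma trVK g A : (forall p, A p -> rpath p /\ psrc p = prng g) ->
  tr (pathV g) (tr g A) = A.
Proof. by move=> AP; rewrite trM pathVM1 tr1. Qed.

Lemma trKV g A : (forall p, A p -> rpath p /\ psrc p = psrc g) ->
  tr g (tr (pathV g) A) = A.
Proof. by move=> AP; rewrite trM pathMV tr1. Qed.

Lemma fork_free_trW g A : fork_free (tr g A) -> fork_free A.
Proof.
move=> fA p X e f CX Xe Xf Ae Af; apply: (fA (pathM g p)) CX Xe Xf _ _.
- by exists (pstep p (inl e)) => //; rewrite pstepM.
- by exists (pstep p (inl f)) => //; rewrite pstepM.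
Qed.

Lemma fork_free_tr g A : (forall p, A p -> rpath p /\ psrc p = prng g) ->
  fork_free A -> fork_free (tr g A).
Proof. by move=> AP fA; apply: (@fork_free_trW (pathV g)); rewrite trVK. Qed.

(** For a tree this is the union of all its representatives. The product with [w] is reduced, so it
    may also cut [t] back; this makes saturation commute with translation. *)
Definition sat T : set gp := [set p | exists2 t, t \in T & exists w,
  [/\ all (@Lletter G) w, path_from (prng t) w & p = pathM t (prng t, w)]]%classic.

Lemma sat_rpath v T p : rooted v T -> sat T p -> rpath p /\ psrc p = v.
Proof.
move=> [_ _ TP] [t tT [w [_ pw ->]]]; have [rt st] := TP _ tT; split=> //.
have pc : path_from t.1 (t.2 ++ w).
  by rewrite path_from_cat -prngE pw andbT; case/andP: rt.
by rewrite /rpath /is_path (path_red pc).1 /= red_reduced.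
Qed.

Lemma sub_sat v T p : rooted v T -> p \in T -> sat T p.
Proof.
move=> [_ _ TP] pT; exists p => //; exists [::]; split=> //.
by have [rp _] := TP _ pT; rewrite (pathM1 (prng p) rp).
Qed.

Lemma satU T S : sat (T `|` S)%fset = (sat T `|` sat S)%classic.
Proof.
apply/seteqP; split=> [p [t tTS h]|p [] [t tT h]].
- by move: tTS; rewrite inE => /orP[tT|tS]; [left|right]; exists t.
- by exists t => //; rewrite inE tT.
- by exists t => //; rewrite inE tT orbT.
Qed.

Lemma sat_translate g T : rpath g -> rooted (prng g) T ->
  sat (translate g T) = tr g (sat T).
Proof.
move=> rg [_ _ TP].
have E t : t \in T -> prng (pathM g t) = prng t.
  by move=> /TP[rt st]; apply: (pathM_rpath rg rt _).2.
apply/seteqP; split=> [p [_ /translateP[t tT ->] [w [Lw pw ->]]]|].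
  rewrite E // in pw *; exists (pathM t (prng t, w)); last by rewrite pathMA.
  by exists t => //; exists w.
move=> _ [_ [t tT [w [Lw pw ->]]] <-]; exists (pathM g t).
  by apply/translateP; exists t.
by exists w; rewrite E // pathMA.
Qed.

(** * Stripping trailing letters *)

Lemma strip_rconsL w x : Lletter x -> strip (rcons w x) = strip w.
Proof. by move=> Lx; elim: w => [|y w IH] /=; [rewrite Lx|rewrite IH]. Qed.

Lemma strip_rconsN w x : ~~ Lletter x -> strip (rcons w x) = rcons w x.
Proof.
move=> /negPf Lx; elim: w => [|y w /= ->] /=; first by rewrite Lx.
by case: w.
Qed.

Lemma strip_rcons_id w x : strip (rcons w x) = rcons w x -> ~~ Lletter x.
Proof.
move=> h; apply/negP => Lx; move: h; rewrite strip_rconsL //.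
have [w' [ww' _ _]] := stripP w; move/(congr1 size); rewrite {2}ww' size_rcons size_cat.
by move=> /eqP; rewrite -addnS -{1}[size _]addn0 eqn_add2l.
Qed.

Lemma strip_prefix w : prefix (strip w) w.
Proof. by have [w' [ww' _ _]] := stripP w; rewrite [X in prefix _ X]ww' prefix_prefix. Qed.

Lemma pL_prefix p : le_pref (pL p) p.
Proof. by rewrite /le_pref eqxx strip_prefix. Qed.

Lemma stripK w : strip (strip w) = strip w.
Proof.
elim/last_ind: w => [//|w x IH].
have [Lx|Lx] := boolP (Lletter x); first by rewrite !strip_rconsL.
by rewrite !strip_rconsN.
Qed.

Lemma pLK p : pL (pL p) = pL p.
Proof. by rewrite /pL /= stripK. Qed.

(** Appending a letter of [w] does not change the stripped path. If the letter cancels instead, the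
    new stripped path is a prefix of the old one, and [T] is prefix-closed. *)
Lemma satP v T p : rooted v T -> sat T p <-> rpath p /\ pL p \in T.
Proof.
move=> rT; have [_ low TP] := rT; split; last first.
  move=> [/andP[pp rp] pLT]; exists (pL p) => //.
  have [w' [ww' Lw' _]] := stripP p.2; exists w'; split=> //.
    by move: pp; rewrite /is_path ww' path_from_cat => /andP[].
  by rewrite /pathM /= -ww' red_id // -surjective_pairing.
move=> sTp; split; first by have [] := sat_rpath rT sTp.
case: sTp => t tT [w [+ + ->]]; have [rt st] := TP _ tT.
elim/last_ind: w => [_ _|w x IH].
  by rewrite (pathM1 (prng t) rt); apply: low (pL_prefix t).
rewrite all_rcons path_from_rcons => /andP[Lx Lw] /andP[pw _].
have {IH} := IH Lw pw; rewrite /pathM /= -rcons_cat -(red_rcons_red (_ ++ _)).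
have [[w' [-> ->]]|->] := red_rcons x (red_reduced (t.2 ++ w)); last first.
  by rewrite /pL /= strip_rconsL.
have [Lx'|Lx'] := boolP (Lletter (linv x)); first by rewrite /pL /= strip_rconsL.
rewrite /pL /= strip_rconsN // => h; apply: low h _.
rewrite /le_pref eqxx /=; apply: prefix_trans (strip_prefix _) _.
exact: prefix_rcons.
Qed.

Lemma sat_prefix v T p q : rooted v T -> sat T p -> le_pref q p -> sat T q.
Proof.
move=> rT; have [_ low _] := rT.
case: p q => [v' w] [_ w'] + /andP[/= /eqP -> /prefixP[c wE]].
move: w' wE; elim/last_ind: c w => [|c x IH] w w' -> sp; first by rewrite cats0 in sp.
rewrite -rcons_cat in sp; apply: (IH _ _ erefl); have [rp pLT] := (satP _ rT).1 sp.
apply/(satP _ rT); split.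
  by apply: rpath_prefix rp; rewrite /le_pref eqxx prefix_rcons.
move: pLT; have [Lx|Lx] := boolP (Lletter x); first by rewrite /pL /= strip_rconsL.
rewrite /pL /= strip_rconsN // => h; apply: low h _; rewrite /le_pref eqxx.
exact: prefix_trans (strip_prefix _) (prefix_rcons _ _).
Qed.

Lemma sat_Lpath T p w : sat T p -> all (@Lletter G) w -> path_from (prng p) w ->
  (forall t, t \in T -> rpath t) -> sat T (pathM p (prng p, w)).
Proof.
move=> [t tT [w' [Lw' pw' pE]]] Lw pw rT; exists t => //; exists (w' ++ w).
have pE' : prng p = pend (prng t) w'.
  rewrite pE prngE /=; have /path_red[_ ->] : path_from t.1 (t.2 ++ w').
    by rewrite path_from_cat pw' andbT; case/andP: (rT _ tT).
  by rewrite pend_cat.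
split; first by rewrite all_cat Lw' Lw.
  by rewrite path_from_cat pw' -pE' pw.
by rewrite /pathM pE /= red_catl catA.
Qed.

Lemma sat_min v T S : rooted v T -> (forall p, p \in S -> sat T p) ->
  (sat S `<=` sat T)%classic.
Proof.
move=> rT ST p [t /ST st [w [Lw pw ->]]]; apply: sat_Lpath => // t' t'T.
by have [_ _ TP] := rT; have [] := TP _ t'T.
Qed.

(** Distinct edges [e], [f] of one block do not satisfy [Lletter], so a path of [sat T] really
    ending in one of them lies in [T]. The other possibility is that the step by [e] undoes a final
    [e^-1] of [p]; then [p.e] is a prefix of [p.f], which does lie in [T]. *)
Lemma fork_free_sat v T : rooted v T -> fork_free [set` T] -> fork_free (sat T).
Proof.
move=> rT fT p X e f CX Xe Xf se sf; apply: contrapT => ef; move: se sf.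
have [_ low _] := rT.
have notL a b : X a -> X b -> a <> b -> ~~ Lletter (inl a : hedge G).
  by move=> Xa Xb; apply: contra_notN; apply: Lletter_block CX Xa Xb.
rewrite -pstep_red -[pstep p (inl f)]pstep_red; set q := (p.1, red p.2).
have rq : reduced q.2 by apply: red_reduced.
have ext a b : X a -> X b -> a <> b -> sat T (pstep q (inl a)) ->
    pstep q (inl a) \in T \/ exists w, q.2 = rcons w (inr a).
  move=> Xa Xb ab /(satP _ rT)[_]; rewrite /pstep /pL /=.
  have [[w [h _]] _|->] := red_rcons (inl a) rq; first by right; exists w.
  by rewrite strip_rconsN ?(notL a b) //; left.
have back a b : X a -> X b -> a <> b -> sat T (pstep q (inl a)) ->
    sat T (pstep q (inl b)) -> pstep q (inl b) \in T -> pstep q (inl a) \in T.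
  move=> Xa Xb ab sa sb; have [//|[w qw]] := ext _ _ Xa Xb ab sa.
  have rE : red (rcons q.2 (inl a)) = w.
    rewrite qw -!cats1 -catA -red_catr /= eqxx cats0 red_id //.
    by move: rq; rewrite qw -cats1 => /reduced_catl.
  have [[w' [qw' _]]|rE'] := red_rcons (inl b) rq.
    by move: qw'; rewrite qw => /rcons_inj[_ [/ab]].
  move=> h; apply: low h _; rewrite /le_pref /pstep /= eqxx rE rE' qw /=.
  by rewrite -!cats1 -catA prefix_prefix.
move=> se sf; apply: (ef); apply: (fT q _ _ _ CX Xe Xf).
(* The two steps cannot both cancel, since [q] has only one last letter. *)
- have [//|[w qw]] := ext _ _ Xe Xf ef se; apply: (back _ _ Xe Xf ef se sf).
  have [//|[w' qw']] := ext _ _ Xf Xe (nesym ef) sf.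
  by move: qw'; rewrite qw => /rcons_inj[_ [/ef]].
- have [//|[w qw]] := ext _ _ Xf Xe (nesym ef) sf; apply: (back _ _ Xf Xe (nesym ef) sf se).
  have [//|[w' qw']] := ext _ _ Xe Xf ef se.
  by move: qw'; rewrite qw => /rcons_inj[_ [/esym/ef]].
Qed.

(** A forbidden turn [e^-1 f] is a fork based just after [e^-1]: the step by [e] goes back, the step
    by [f] goes on, and both ends are prefixes of [p]. *)
Lemma fork_free_FC v T p : rooted v T -> fork_free [set` T] -> p \in T -> FC p.
Proof.
case: p => v' w [_ low TP] fT pT; have [/andP[pp rp] _] := TP _ pT.
rewrite /FC pp rp /=; elim/last_ind: w pT {pp rp} => [//|w x IH] wxT.
have [/andP[_ rwx] _] := TP _ wxT.
have wT : (v', w) \in T by apply: low wxT _; rewrite /le_pref eqxx prefix_rcons.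
have {IH} := IH wT; case: (lastP w) wxT rwx wT => [//|w' y] wxT rwx wT Cw.
rewrite /Cseparated -!cats1 -catA /=.
suff nC : ~~ Cturn y x.
  move: Cw; rewrite /Cseparated; case: w' {wxT rwx wT} => [|z w'] /=.
    by rewrite nC.
  by rewrite rcons_path cat_path /= => /andP[-> ->]; rewrite nC.
apply/negP; case: y x wxT rwx wT {Cw} => [//|e] [f|//] wxT rwx wT /=.
move=> /asboolP[X [CX Xe Xf]].
have rw' : reduced w'.
  by move: rwx; rewrite /= -!cats1 -catA => /reduced_catl.
suff ef : e = f.
  move: rwx; rewrite ef /= -!cats1 -catA => /reduced_catr.
  by rewrite /reduced /= eqxx.
apply: (fT (v', rcons w' (inr e)) X) => //=; rewrite /pstep /=.
- rewrite -!cats1 -catA -red_catr /= eqxx cats0 red_id //.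
  by apply: low wT _; rewrite /le_pref eqxx prefix_rcons.
- by rewrite red_id.
Qed.

(** The quotient of the two ends of a fork is [e^-1 f], which is not C-separated. Conversely
    [q^-1 . p] lies in the translate of [T] by [q^-1], again prefix-closed and fork-free, so all its
    paths are C-separated. *)
Lemma rooted_compatible v T : rooted v T -> Ccompatible v T <-> fork_free [set` T].
Proof.
move=> rT; have [_ low TP] := rT; split.
  move=> [_ cT] p X e f CX Xe Xf /= Te Tf; apply: contrapT => ef.
  have /and3P[_ _] := cT _ _ Tf Te; rewrite /pathM /=.
  rewrite -red_winv red_catl red_catr -!cats1 winv_cat -catA (catA (winv p.2)).
  rewrite -red_catr -(red_catl (winv p.2 ++ p.2)) red_winvl red_catr.
  have -> : red ([:: inr e] ++ [:: inl f]) = [:: inr e; inl f : hedge G].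
    by rewrite /= ifN //; apply/eqP => -[/esym].
  by rewrite /Cseparated /= andbT => /asboolPn; apply; exists X.
move=> fT; split=> [p pT|p q pT qT].
  by split; [apply: (fork_free_FC rT fT pT)|case: (TP _ pT)].
have [rq sq] := TP _ qT.
apply: (@fork_free_FC (prng q) (translate (pathV q) T)).
- exact: (rooted_translateV rT qT).
- have -> : [set` translate (pathV q) T]%classic = tr (pathV q) [set` T].
    apply/seteqP; split=> [_ /= /translateP[h hT ->]|_ [h hT <-]]; first by exists h.
    by apply/translateP; exists h.
  by apply: fork_free_tr => // h /= /TP[rh sh]; rewrite (pathV_rpath rq).2 sh sq.
- by apply/translateP; exists p.
Qed.

Lemma X_atP v T : X_at v T <-> rooted v T /\ fork_free [set` T].
Proof.
split=> [[T0 low cT]|[rT fT]]; last first.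
  by have [T0 low TP] := rT; split=> //; apply/rooted_compatible.
have rT : rooted v T.
  split=> // p pT; have [/and3P[pp rp _] sp] := cT.1 _ pT.
  by rewrite /rpath pp rp.
by split=> //; apply: (rooted_compatible rT).1 cT.
Qed.

Lemma X_at_rooted v T : X_at v T -> rooted v T.
Proof. by case/X_atP. Qed.

Lemma X_at_sat v T : X_at v T -> fork_free (sat T).
Proof. by case/X_atP => rT /(fork_free_sat rT). Qed.

Lemma X_atI v T A : rooted v T -> (sat T `<=` A)%classic -> fork_free A -> X_at v T.
Proof.
move=> rT TA fA; apply/X_atP; split=> //; apply: fork_free_sub fA => p pT.
by apply/TA/(sub_sat rT).
Qed.

(** * Stripped trees as canonical members of their class *)

Lemma rooted_TL v T : rooted v T -> rooted v (TL T).
Proof.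
move=> rT; have [/eqP/fset0Pn[t tT] low TP] := rT; apply: rooted_down => [|p].
  by apply/eqP/fset0Pn; exists (pL t); apply/imfsetP; exists t.
move=> /imfsetP[q /= qT ->]; apply: TP; exact: low qT (pL_prefix q).
Qed.

(** The right-hand side sees [T] only through its saturation; hence [TL] is constant on trees with
    the same saturation. *)
Lemma TLP v T q : rooted v T -> q \in TL T <-> exists2 p, sat T p & le_pref q (pL p).
Proof.
move=> rT; split=> [/pref_downP[_ /imfsetP[p /= pT ->] qp]|[p]].
  by exists p => //; apply: sub_sat rT pT.
move=> /(satP _ rT)[_ pLT] qp; apply/pref_downP; exists (pL p) => //.
by apply/imfsetP; exists (pL p); rewrite ?pLK.
Qed.

Lemma TL_sat v v' T S : rooted v T -> rooted v' S -> sat T = sat S -> TL T = TL S.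
Proof.
move=> rT rS TS; apply/fsetP => q; apply/idP/idP.
  by move=> /(TLP _ rT); rewrite TS => /(TLP _ rS).
by move=> /(TLP _ rS); rewrite -TS => /(TLP _ rT).
Qed.

Lemma sat_TL v T : rooted v T -> sat (TL T) = sat T.
Proof.
move=> rT; have rTL := rooted_TL rT; have [_ low _] := rT.
apply/seteqP; split=> p /[dup] h; rewrite (satP _ rTL) (satP _ rT) => -[rp hp].
  split=> //; have [q sq pq] := (TLP (pL p) rT).1 hp.
  by have [_ qT] := (satP q rT).1 sq; apply: low qT pq.
by split=> //; apply/(TLP _ rT); exists p => //; apply: le_pref_refl.
Qed.

Lemma pref_maximal_exists T p : p \in T -> exists2 q, pref_maximal T q & le_pref p q.
Proof.
move=> pT.
pose P n := [exists q : T, le_pref p (val q) && (size (val q).2 == n)].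
have exP : exists n, P n.
  by exists (size p.2); apply/existsP; exists [` pT]%fset; rewrite le_pref_refl /=.
have bP n : P n -> n <= \max_(q : T) size (val q).2.
  by move=> /existsP[q /andP[_ /eqP <-]]; apply: (leq_bigmax q).
case: (ex_maxnP exP bP) => n /existsP[q /andP[pq /eqP qn]] nmax.
exists (val q) => //; split=> [|r rT qr]; first exact: valP.
have rn : size r.2 <= size (val q).2.
  rewrite qn; apply: nmax; apply/existsP; exists [` rT]%fset => /=.
  by rewrite (le_pref_trans pq qr) eqxx.
case/andP: qr => /eqP q1 /prefixP[[|x c] rE]; last first.
  by move: rn; rewrite rE size_cat /= addnS ltnNge leq_addr.
by rewrite (surjective_pairing r) rE cats0 -q1 -surjective_pairing.
Qed.

(** The condition on maximal elements says that each of them equals its stripped form. Conversely,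
    if [TL T = T], a maximal [p] lies below some [pL q] in [T] and must be equal to it. *)
Lemma X_LP v T : X_L v T <-> X_at v T /\ TL T = T.
Proof.
split=> [[XT mT]|[XT TT]]; have rT := X_at_rooted XT; have [_ low _] := rT.
  split=> //; apply/fsetP => q; apply/idP/idP.
    move=> /(TLP _ rT)[p sp qp]; have [_ pT] := (satP p rT).1 sp.
    exact: low pT qp.
  move=> /pref_maximal_exists[p mp qp]; apply/(TLP _ rT); exists p.
    exact: sub_sat rT mp.1.
  suff pE : strip p.2 = p.2 by rewrite /pL pE -surjective_pairing.
  have := mT p; case: (lastP p.2) => [//|w x] /(_ w x mp erefl) Nx.
  by rewrite strip_rconsN.
split=> // p w x [pT mp] pw; rewrite -TT in pT.
have [q sq pq] := (TLP p rT).1 pT; have [_ qT] := (satP q rT).1 sq.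
have := mp _ qT pq; case: (boolP (Lletter x)) => // Lx qE.
have := stripK q.2; rewrite (congr1 snd qE : strip q.2 = p.2) pw.
by move=> /strip_rcons_id; rewrite Lx.
Qed.

Lemma X_L_TL v T : X_at v T -> X_L v (TL T).
Proof.
move=> XT; have rT := X_at_rooted XT; have rTL := rooted_TL rT; apply/X_LP; split.
  by apply: (X_atI rTL _ (X_at_sat XT)); rewrite (sat_TL rT).
by apply: (TL_sat rTL rT); apply: sat_TL rT.
Qed.

Lemma X_L_inj v v' T S : X_L v T -> X_L v' S -> sat T = sat S -> T = S.
Proof.
move=> /X_LP[XT <-] /X_LP[XS <-].
by rewrite !(sat_TL (X_at_rooted XT)) !(sat_TL (X_at_rooted XS)); apply: TL_sat; apply: X_at_rooted; eassumption.
Qed.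

End Saturation.

(** * The congruence [simL] and saturations *)

Section Configurations.
Variable G : sepgraph.
Local Notation gp := (gpath G).
Implicit Types (p q r g : gp) (v : vertex G) (w : seq (hedge G)) (x : hedge G).
Implicit Types (T S : {fset gp}) (A B : set gp).

Lemma FC_rpath p : FC p -> rpath p.
Proof. by move=> /and3P[pp rp _]; rewrite /rpath pp. Qed.

Lemma X_at_FC v T p : X_at v T -> p \in T -> FC p.
Proof. by move=> [_ _ [h _]] /h[]. Qed.

(** Two prefixes of one path are comparable. If both steps of a fork cancel, or both extend, the
    edges agree; if one cancels and the other extends, [p] contains a forbidden turn. *)
Lemma X_at_down1 p : FC p -> X_at (psrc p) (pref_down [fset p]%fset).
Proof.
move=> FCp; have rp := FC_rpath FCp; have rT := rooted_down1 rp.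
apply/X_atP; split=> // q X e f CX Xe Xf /=.
rewrite !down1P -pstep_red -[pstep q (inl f)]pstep_red.
move=> /andP[_ /prefixP[c /= pe]] /andP[_ /prefixP[d /= pf]].
have turn a b u c' : X a -> X b -> p.2 = rcons (rcons u (inr a)) (inl b) ++ c' -> False.
  move=> Xa Xb pE; case/and3P: FCp => _ _; rewrite /Cseparated pE -!cats1 -!catA.
  case: u {pE} => [|y u] /=; last rewrite cat_path /=.
    by move=> /andP[/asboolPn[]]; exists X.
  by move=> /andP[_ /andP[_ /andP[/asboolPn[]]]]; exists X.
have rq := red_reduced q.2; move: pe pf.
have [[u [qE ->]]|->] := red_rcons (inl e) rq;
  have [[u' [qE' ->]]|->] := red_rcons (inl f) rq.
- by move: qE; rewrite qE' => /rcons_inj[_ ->].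
- by rewrite qE => _ /(turn _ _ _ _ Xe Xf).
- by rewrite qE' => /(turn _ _ _ _ Xf Xe).
- by move=> ->; rewrite -!cats1 -!catA => /eqP; rewrite eqseq_cat // => /andP[_ /eqP[]].
Qed.

Lemma saturateP v T g : X_at v T -> sat T g ->
  X_at v (saturate T g) /\ sat (saturate T g) = sat T.
Proof.
move=> XT sg; have rT := X_at_rooted XT; have [rg eg] := sat_rpath rT sg.
have E : sat (saturate T g) = sat T.
  rewrite satU; apply/setUidPl; apply: (sat_min rT) => q; rewrite down1P.
  exact: sat_prefix rT sg.
split=> //; apply: (X_atI _ _ (X_at_sat XT)); last by rewrite E.
by apply: rootedU => //; rewrite -eg; apply: rooted_down1.
Qed.

Lemma mem_saturate T g : g \in saturate T g.
Proof. by rewrite inE down1P le_pref_refl orbT. Qed.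

Lemma X_at_sat_FC v T p : X_at v T -> sat T p -> FC p.
Proof.
by move=> XT /(saturateP XT)[XT' _]; apply: X_at_FC XT' (mem_saturate _ _).
Qed.

Definition xsat (x : Xsl G) : set gp := if x is Some T then sat (val T) else set0.

Lemma toXE v T : X_at v T -> exists2 t, toX T = Some t & val t = T.
Proof.
move=> XT; have tT : is_tree T by apply/asboolP; exists v.
by exists (exist _ T tT) => //; rewrite /toX insubT.
Qed.

Lemma toX_val (t : {T : {fset gp} | is_tree T}) :
  toX (val t) = Some t /\ exists v, X_at v (val t).
Proof. by rewrite /toX valK; split=> //; apply/asboolP/(valP t). Qed.

Lemma xsat_toX v T : X_at v T -> xsat (toX T) = sat T.
Proof. by move=> /toXE[t -> /= ->]. Qed.

Lemma sat_vpath v T : rooted v T -> sat T (vpath v).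
Proof. by move=> rT; apply: (sub_sat rT (rooted_vpath rT)). Qed.

Lemma sat_root v v' T : rooted v T -> sat T (vpath v') -> v' = v.
Proof. by move=> rT /(sat_rpath rT)[_ <-]. Qed.

(** The product of [Xsl] read on saturations. The only vertex in the saturation of a tree is its
    root, so a common vertex means a common root; the empty set stands for zero. *)
Definition smul A B : set gp :=
  if `[< exists v, [/\ A (vpath v), B (vpath v) & fork_free (A `|` B)%classic] >]
  then (A `|` B)%classic else set0.

Lemma xsatM (x y : Xsl G) : xsat (x * y) = smul (xsat x) (xsat y).
Proof.
have smul0 A B : (forall v, ~ A (vpath v)) \/ (forall v, ~ B (vpath v)) -> smul A B = set0.
  by move=> h; rewrite /smul; case: asboolP => // -[v [Av Bv _]]; case: h => /(_ v).
case: x y => [t|] [s|]; last 3 first.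
- by rewrite smul0 //; right=> v [].
- by rewrite smul0 //; left=> v [].
- by rewrite smul0 //; left=> v [].
have [_ [v Xt]] := toX_val t; have [_ [v' Xs]] := toX_val s.
have rt := X_at_rooted Xt; have rs := X_at_rooted Xs.
change (xsat (Xmul (Some t) (Some s)) = smul (sat (val t)) (sat (val s))).
rewrite /Xmul /smul.
case: asboolP => [[u [Xt' Xs' cU]]|nU]; case: asboolP => [[u' [su' su'' fU]]|nU'] //.
- have rU := rootedU (X_at_rooted Xt') (X_at_rooted Xs').
  rewrite (@xsat_toX u) ?satU //; apply/X_atP; split=> //.
  exact: (rooted_compatible rU).1 cU.
- case: nU'; exists u; split.
  + exact/sat_vpath/X_at_rooted.
  + exact/sat_vpath/X_at_rooted.
  + have rU := rootedU (X_at_rooted Xt') (X_at_rooted Xs').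
    rewrite -satU; apply: (fork_free_sat rU); exact: (rooted_compatible rU).1 cU.
- case: nU; have uv := sat_root rt su'; have uv' := sat_root rs su''.
  have vv : v = v' by rewrite -uv -uv'.
  rewrite -vv in Xs rs; exists v; split=> //; have rU := rootedU rt rs.
  apply: (rooted_compatible rU).2; apply: fork_free_sub fU => p pU.
  by rewrite -satU; apply: sub_sat rU pU.
Qed.

Lemma sat_down_rcons v w x : rpath (v, rcons w x) -> Lletter x ->
  sat (pref_down [fset (v, rcons w x)]%fset) = sat (pref_down [fset (v, w)]%fset).
Proof.
move=> rwx Lx; have wx : le_pref (v, w) (v, rcons w x).
  by rewrite /le_pref eqxx prefix_rcons.
have rw := rpath_prefix wx rwx.
apply/seteqP; split=> p /(satP _ (rooted_down1 _)); rewrite down1P => h;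
  apply/(satP _ (rooted_down1 _)); rewrite // down1P.
- have [rp /andP[/= /eqP pv /prefix_rcons_inv[|pE]]] := h rwx.
    by move=> ppw; rewrite /le_pref /= pv eqxx.
  (* A stripped word never ends in a letter satisfying [Lletter], so [pL p] is not the longer
     path. *)
  by have := strip_rcons_id (w := w) (x := x); rewrite -pE stripK Lx => /(_ erefl).
- by have [rp pw] := h rw; split=> //; apply: le_pref_trans pw wx.
Qed.

Lemma simL_xsat (x y : Xsl G) : simL x y -> xsat x = xsat y.
Proof.
have gen v w z : FC (v, rcons w z) -> Lletter z ->
    xsat (toX (pref_down [fset (v, rcons w z)]%fset)) =
    xsat (toX (pref_down [fset (v, w)]%fset)).
  move=> FCp Lz; have FCw : FC (v, w).
    apply: (X_at_FC (X_at_down1 FCp)); rewrite down1P.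
    by rewrite /le_pref eqxx prefix_rcons.
  rewrite (xsat_toX (X_at_down1 FCp)) (xsat_toX (X_at_down1 FCw)).
  exact: sat_down_rcons (FC_rpath FCp) Lz.
elim=> {x y} //.
- by move=> v w e FCp; apply: gen.
- by move=> v w e Ce FCp; apply: gen => //; apply/asboolP.
- by move=> x y z _ -> _ ->.
- by move=> x y z _ E; rewrite !xsatM E.
- by move=> x y z _ E; rewrite !xsatM E.
Qed.

Lemma toXU v T S : X_at v T -> X_at v S -> X_at v (T `|` S)%fset ->
  toX T * toX S = toX (T `|` S)%fset.
Proof.
move=> XT XS XU; have [t tE tT] := toXE XT; have [s sE sS] := toXE XS.
rewrite tE sE; change (Xmul (Some t) (Some s) = toX (T `|` S)%fset).
rewrite /Xmul tT sS.
by case: asboolP => // -[]; exists v; split=> //; case: XU.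
Qed.

Lemma simL_down_pL p : FC p ->
  simL (toX (pref_down [fset p]%fset)) (toX (pref_down [fset pL p]%fset)).
Proof.
case: p => v w; elim/last_ind: w => [|w x IH] FCp; first exact: simL_refl.
have FCw : FC (v, w).
  by apply: (X_at_FC (X_at_down1 FCp)); rewrite down1P /le_pref eqxx prefix_rcons.
have [Lx|Lx] := boolP (Lletter x); rewrite /pL /=.
  rewrite strip_rconsL //; apply: simL_trans (IH FCw).
  case: x Lx FCp => [e /asboolP Ce|e _] FCp; first exact: simL_edge.
  exact: simL_inverse.
by rewrite strip_rconsN //; apply: simL_refl.
Qed.

(** Since [pL g] lies in [T], multiplying by its prefixes leaves [T] unchanged, and in that factor
    [pL g] may be replaced by the equivalent [g]. *)
Lemma simL_saturate v T g : X_at v T -> sat T g ->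
  simL (toX T) (toX (saturate T g)).
Proof.
move=> XT sg; have rT := X_at_rooted XT; have [XS _] := saturateP XT sg.
have [_ low _] := rT; have FCg := X_at_sat_FC XT sg.
have [_ pLT] := (satP _ rT).1 sg; have Xg := X_at_down1 FCg.
have [_ eg] := sat_rpath rT sg; rewrite eg in Xg.
have XgL := X_at_down1 (X_at_FC XT pLT); rewrite [psrc _]eg in XgL.
have TE : (T `|` pref_down [fset pL g] = T)%fset.
  by apply/fsetUidPl/fsubsetP => q; rewrite down1P; apply: low.
rewrite -{1}TE /saturate -(toXU XT XgL) ?TE // -(toXU XT Xg) //.
by apply/simL_mull/simL_sym/simL_down_pL.
Qed.

(** The exact description of the members of [S'] allows two trees to be enlarged to literally the
    same set. *)
Lemma simL_saturates v S (l : seq gp) : X_at v S -> (forall p, p \in l -> sat S p) ->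
  exists S', [/\ X_at v S', simL (toX S) (toX S'), sat S' = sat S &
    forall p, p \in S' <-> p \in S \/ exists2 q, q \in l & le_pref p q].
Proof.
move=> XS; elim: l => [_|g l IH lS].
  exists S; split=> //; first exact: simL_refl.
  by move=> p; split=> [|[//|[]//]]; left.
have [p pl|S' [XS' SS' sS' S'P]] := IH; first by apply: lS; rewrite inE pl orbT.
have sg : sat S' g by rewrite sS'; apply: lS; rewrite inE eqxx.
have [XS'' sS''] := saturateP XS' sg.
exists (saturate S' g); split=> //.
- exact: simL_trans SS' (simL_saturate XS' sg).
- by rewrite sS''.
- move=> p; rewrite inE down1P; split.
    case/orP => [/S'P[|[q ql pq]]|pg]; first by left.
      by right; exists q; rewrite ?inE ?ql ?orbT.
    by right; exists g; rewrite ?inE ?eqxx.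
  case=> [pS|[q]]; first by apply/orP; left; apply/S'P; left.
  rewrite inE => /orP[/eqP-> ->|ql pq]; first by rewrite orbT.
  by apply/orP; left; apply/S'P; right; exists q.
Qed.

(** Each tree can absorb the paths of the other, which lie in the common saturation; both are thus
    equivalent to their union. *)
Lemma simL_sat v T S : X_at v T -> X_at v S -> sat T = sat S -> simL (toX T) (toX S).
Proof.
move=> XT XS TS; have rT := X_at_rooted XT; have rS := X_at_rooted XS.
have [|T' [_ TT' _ T'P]] := @simL_saturates v T (enum_fset S) XT.
  by move=> p pS; rewrite TS; apply: sub_sat rS pS.
have [|S' [_ SS' _ S'P]] := @simL_saturates v S (enum_fset T) XS.
  by move=> p pT; rewrite -TS; apply: sub_sat rT pT.
suff E : T' = S' by rewrite -E in SS'; apply: simL_trans TT' (simL_sym SS').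
have aux v' U p : rooted v' U -> (exists2 q, q \in enum_fset U & le_pref p q) <-> p \in U.
  move=> [_ low _]; split=> [[q qU pq]|pU]; first exact: low qU pq.
  by exists p => //; apply: le_pref_refl.
apply/fsetP => p; apply/idP/idP.
  move=> /T'P[pT|/(aux _ _ _ rS) pS]; apply/S'P; last by left.
  by right; apply/(aux _ _ _ rT).
move=> /S'P[pS|/(aux _ _ _ rT) pT]; apply/T'P; last by left.
by right; apply/(aux _ _ _ rS).
Qed.

Lemma simLP (x y : Xsl G) : simL x y <-> xsat x = xsat y.
Proof.
split=> [/simL_xsat//|].
have ne t : xsat (Some t) <> set0.
  have [_ [v /X_at_rooted/sat_vpath h]] := toX_val t.
  by move=> /seteqP[/(_ _ h)].
case: x y => [t|] [s|] //; last by move=> _; apply: simL_refl.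
- have [<- [v Xt]] := toX_val t; have [<- [v' Xs]] := toX_val s.
  rewrite (xsat_toX Xt) (xsat_toX Xs) => ts.
  apply: (simL_sat Xt) => //; suff -> : v = v' by [].
  by apply: (sat_root (X_at_rooted Xs)); rewrite -ts; apply/sat_vpath/X_at_rooted.
- by move=> /ne.
- by move=> /esym/ne.
Qed.

(** * Configurations: saturations of trees with a given root *)

Definition conf v A : Prop := exists2 T, X_at v T & A = sat T.

Lemma conf_FC v A p : conf v A -> A p -> FC p.
Proof. by move=> [T XT ->]; apply: (X_at_sat_FC XT). Qed.

Lemma conf_path v A p : conf v A -> A p -> rpath p /\ psrc p = v.
Proof. by move=> [T /X_at_rooted rT ->]; apply: sat_rpath. Qed.

Lemma conf_ff v A : conf v A -> fork_free A.
Proof. by move=> [T XT ->]; exact: (X_at_sat XT). Qed.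

Lemma conf_vpath v A : conf v A -> A (vpath v).
Proof. by move=> [T /X_at_rooted rT ->]; apply: sat_vpath. Qed.

Lemma conf_root v v' A : conf v A -> A (vpath v') -> v' = v.
Proof. by move=> [T /X_at_rooted rT ->]; apply: sat_root. Qed.

Lemma conf_rep v A g : conf v A -> A g -> exists T, [/\ X_at v T, g \in T & A = sat T].
Proof.
move=> [T XT ->] sg; have [XS <-] := saturateP XT sg; exists (saturate T g).
by split=> //; apply: mem_saturate.
Qed.

Lemma X_at_product v T g S : X_at v T -> g \in T -> X_at (prng g) S ->
  rooted v (T `|` translate g S)%fset /\
  sat (T `|` translate g S)%fset = (sat T `|` tr g (sat S))%classic.
Proof.
move=> XT gT XS; have rT := X_at_rooted XT; have rS := X_at_rooted XS.
have rg := FC_rpath (X_at_FC XT gT).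
by split; [apply: rooted_product|rewrite satU sat_translate].
Qed.

Lemma confM v A g B : conf v A -> A g -> conf (prng g) B ->
  fork_free (A `|` tr g B)%classic -> conf v (A `|` tr g B)%classic.
Proof.
move=> cA Ag [S XS ->]; have [T [XT gT ->]] := conf_rep cA Ag.
have [rU sU] := X_at_product XT gT XS; rewrite -sU => fU.
exists (T `|` translate g S)%fset => //; exact: X_atI rU _ fU.
Qed.

Lemma X_at_translateV v T g : X_at v T -> g \in T ->
  X_at (prng g) (translate (pathV g) T) /\
  sat (translate (pathV g) T) = tr (pathV g) (sat T).
Proof.
move=> XT gT; have rT := X_at_rooted XT; have [rg sg] := sat_rpath rT (sub_sat rT gT).
have [rV gV] := pathV_rpath rg.
have sE : sat (translate (pathV g) T) = tr (pathV g) (sat T).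
  by apply: sat_translate => //; rewrite gV sg.
split=> //; apply: (@X_atI _ _ _ (tr (pathV g) (sat T)) (rooted_translateV rT gT)).
  by rewrite sE.
apply: (fork_free_tr _ (X_at_sat XT)) => p sp.
by rewrite gV sg; apply: sat_rpath rT sp.
Qed.

Lemma conf_trV v A g : conf v A -> A g -> conf (prng g) (tr (pathV g) A).
Proof.
move=> cA Ag; have [T [XT gT ->]] := conf_rep cA Ag.
by have [XS <-] := X_at_translateV XT gT; exists (translate (pathV g) T).
Qed.

Lemma confU v A B : conf v A -> conf v B -> fork_free (A `|` B)%classic ->
  conf v (A `|` B)%classic.
Proof.
move=> cA cB; rewrite -(tr1 (fun p => @conf_path v B p cB)) => fU.
by apply: confM fU => //; apply: conf_vpath cA.
Qed.

Lemma conf_down1 p : FC p -> conf (psrc p) (sat (pref_down [fset p]%fset)).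
Proof. by move=> FCp; exists (pref_down [fset p]%fset) => //; apply: X_at_down1. Qed.

Lemma conf_trVV v A g : conf v A -> A g -> tr (pathV g) A (pathV g).
Proof.
move=> cA Ag; exists (vpath v); first exact: conf_vpath cA.
by have [rg sg] := conf_path cA Ag; rewrite pathM1 //; have [] := pathV_rpath rg.
Qed.

Lemma conf_trVK v A g : conf v A -> A g -> tr g (tr (pathV g) A) = A.
Proof.
move=> cA Ag; have [rg sg] := conf_path cA Ag; apply: trKV => p Ap.
by rewrite sg; apply: conf_path cA Ap.
Qed.

Lemma representativeP v T S : X_L v T ->
  representative T S <-> X_at v S /\ sat S = sat T.
Proof.
move=> /X_LP[XT _]; split=> [[/asboolP[v' XS]] /simLP|[XS ST]]; last first.
  by split; [apply/asboolP; exists v|apply/simLP; rewrite (xsat_toX XS) (xsat_toX XT)].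
rewrite (xsat_toX XS) (xsat_toX XT) => E; split=> //; suff <- : v' = v by [].
by apply: (sat_root (X_at_rooted XT)); rewrite -E; apply/sat_vpath/X_at_rooted.
Qed.

(** By [satP], the condition on the stripped path means that [g] itself lies in the saturation; this
    fixes the source of [g] and makes it C-separated. *)
Lemma is_LMP T g : is_LM (T, g) <-> X_L (psrc g) T /\ sat T g.
Proof.
split=> [/asboolP[/= [v XLT] FCg pLg]|[XLT sg]]; last first.
  have /X_LP[XT _] := XLT; apply/asboolP; split=> /=; first by exists (psrc g).
    exact: X_at_sat_FC XT sg.
  by have [] := (satP g (X_at_rooted XT)).1 sg.
have /X_LP[XT _] := XLT; have sg : sat T g.
  by apply/(satP _ (X_at_rooted XT)); split=> //; apply: FC_rpath.
by have [_ ->] := sat_rpath (X_at_rooted XT) sg.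
Qed.

End Configurations.

(** * The inverse semigroup of Leavitt-Munn trees *)

(** Regular semigroups with commuting idempotents are inverse: two inverses [t] and [u] of [s] are
    both equal to [u s t]. *)
Lemma inverse_semigroup0I (S : magma0Type) : semigroup0 S ->
  (forall s : S, exists t, is_inverse s t) ->
  (forall e f : S, e * e = e -> f * f = f -> e * f = f * e) ->
  inverse_semigroup0 S.
Proof.
move=> sS iS cS; split=> // s; have [A _ _] := sS; have [t [sts tst]] := iS s.
exists t; split=> // u [sus usu].
have idl (a b : S) : a * b * a = a -> a * b * (a * b) = a * b.
  by move=> aba; rewrite A aba.
have tE : t = u * s * t.
  have := cS _ _ (idl _ _ tst) (idl _ _ usu); rewrite !A => e.
  by rewrite -{1}tst -{1}sus !A e -(A (u * s)) -(A (u * s)) tst.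
have uE : u = u * s * t.
  have := cS _ _ (idl _ _ sts) (idl _ _ sus); rewrite -!A => e.
  by rewrite -{1}usu -{1}sts -!A e !A usu.
by rewrite tE -uE.
Qed.

Section LeavittMunnTrees.
Variable G : sepgraph.
Local Notation gp := (gpath G).
Implicit Types (p q r g h : gp) (v : vertex G) (w : seq (hedge G)).
Implicit Types (T S : {fset gp}) (A B : set gp) (x y z : LM G).
Implicit Types (t s : {fset gp} * gp) (a b c : set gp * gp).

Definition skey (t : {fset gp} * gp) : set gp * gp := (sat t.1, t.2).

(** Injective coordinates in which neither stripping nor representatives appear; identities in [LM]
    are checked on them. *)
Definition key x : option (set gp * gp) := omap skey (LM_val x).

Lemma skey_inj t s : is_LM t -> is_LM s -> skey t = skey s -> t = s.
Proof.
case: t s => [T g] [S h] /is_LMP[XT _] /is_LMP[XS _] [TS /= gh].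
by rewrite gh (X_L_inj XT XS TS).
Qed.

Lemma key_inj : injective key.
Proof.
move=> [t|] [s|] //= [] TS gh; congr Some; apply: val_inj.
by apply: skey_inj; [apply: valP|apply: valP|rewrite /skey TS gh].
Qed.

Lemma toLM_val t : is_LM t -> LM_val (toLM t) = Some t.
Proof. by move=> Lt; rewrite /LM_val /toLM insubT. Qed.

Lemma key_toLM t : is_LM t -> key (toLM t) = Some (skey t).
Proof. by move=> Lt; rewrite /key toLM_val. Qed.

Definition pconf (a : set gp * gp) : Prop := conf (psrc a.2) a.1 /\ a.1 a.2.

Lemma skeyP t : is_LM t -> pconf (skey t).
Proof.
case: t => T g /is_LMP[/X_LP[XT _] sg]; split=> //; by exists T.
Qed.

Lemma keyP x a : key x = Some a -> pconf a.
Proof. by case: x => // t [<-]; apply/skeyP/valP. Qed.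

Lemma key_ex a : pconf a -> exists x, key x = Some a.
Proof.
case: a => A g [[T XT /= ->] sg]; have rT := X_at_rooted XT.
have Lt : is_LM (TL T, g).
  by apply/is_LMP; rewrite (sat_TL rT); split=> //; apply: X_L_TL.
by exists (toLM (TL T, g)); rewrite key_toLM // /skey /= (sat_TL rT).
Qed.

Definition kmul (a b : set gp * gp) : option (set gp * gp) :=
  if `[< prng a.2 = psrc b.2 /\ fork_free (a.1 `|` tr a.2 b.1)%classic >]
  then Some ((a.1 `|` tr a.2 b.1)%classic, pathM a.2 b.2) else None.

(** [kmul] depends on the trees only through their saturations, so this yields independence of the
    representatives as well as the product formula. *)
Lemma LM_prodP v T g S h : X_at v T -> g \in T -> X_at (psrc h) S -> h \in S ->
  omap skey (LM_prod T g S h) = kmul (sat T, g) (sat S, h) /\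
  (forall t, LM_prod T g S h = Some t -> is_LM t).
Proof.
move=> XT gT XS hS; rewrite /LM_prod /kmul /=.
have [_ sg] := sat_rpath (X_at_rooted XT) (sub_sat (X_at_rooted XT) gT).
case: asboolP => [[gh [u cU]]|nU]; case: asboolP => [[gh' fU]|nU'] //.
- rewrite -gh in XS; have [rU sU] := X_at_product XT gT XS.
  have XU : X_at v (T `|` translate g S)%fset by apply: X_atI rU _ fU; rewrite sU.
  split=> [|_ [<-]]; first by rewrite /skey /= (sat_TL rU) sU.
  apply/is_LMP; rewrite [psrc (pathM g h)]sg (sat_TL rU) sU; split; first exact: X_L_TL.
  by right; exists h => //; apply: (sub_sat (X_at_rooted XS) hS).
- case: nU'; split=> //; rewrite -gh in XS.
  have [rU <-] := X_at_product XT gT XS.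
  apply: (fork_free_sat rU); apply: (rooted_compatible rU).1.
  (* The root supplied by compatibility is the source of [g], because [g] lies in the union. *)
  have gU : g \in (T `|` translate g S)%fset by rewrite inE gT.
  by have [_] := cU.1 _ gU; rewrite [psrc _]sg => ->.
- case: nU; split=> //; rewrite -gh' in XS.
  have [rU sU] := X_at_product XT gT XS; exists v.
  apply: (rooted_compatible rU).2; apply: fork_free_sub fU => p pU.
  by rewrite -sU; apply: sub_sat rU pU.
Qed.

Lemma keyM x y : key (x * y) = obind (fun a => obind (kmul a) (key y)) (key x).
Proof.
case: x y => [t|] [s|] //.
change (key (LM_mul (Some t) (Some s)) = kmul (skey (val t)) (skey (val s))).
rewrite /LM_mul; case: t s => [[T g] Lt] [[S h] Ls] /=.
have [/X_LP[XT _] sg] := (is_LMP T g).1 Lt.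
have [/X_LP[XS _] sh] := (is_LMP S h).1 Ls.
have [XT' sT'] := saturateP XT sg; have [XS' sS'] := saturateP XS sh.
have [] := LM_prodP XT' (mem_saturate T g) XS' (mem_saturate S h).
rewrite sT' sS' => <-; case: LM_prod => //= t' /(_ _ erefl) Lt'.
exact: key_toLM.
Qed.

Lemma keyM_some x y a b : key x = Some a -> key y = Some b -> key (x * y) = kmul a b.
Proof. by rewrite keyM => -> ->. Qed.

Lemma key_none x : key x = None -> x = null.
Proof. by case: x. Qed.

Lemma toLM_mul T1 T2 T1' T2' g1 g2 : is_LM (T1, g1) -> is_LM (T2, g2) ->
  representative T1 T1' -> g1 \in T1' -> representative T2 T2' -> g2 \in T2' ->
  LM_val (toLM (T1, g1) * toLM (T2, g2)) = LM_prod T1' g1 T2' g2.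
Proof.
move=> L1 L2 R1 gT1 R2 gT2.
have [XL1 _] := (is_LMP T1 g1).1 L1; have [XL2 _] := (is_LMP T2 g2).1 L2.
have [X1 s1] := (representativeP _ XL1).1 R1; have [X2 s2] := (representativeP _ XL2).1 R2.
have [] := LM_prodP X1 gT1 X2 gT2; rewrite s1 s2 => E Lp.
have := keyM_some (key_toLM L1) (key_toLM L2); rewrite -[kmul _ _]E.
case: (_ * _) => [t|]; case: LM_prod Lp {E} => [s|] //= /(_ s erefl) Ls [st gh].
by congr Some; apply: skey_inj => //; [apply: valP|rewrite /skey st gh].
Qed.

(** For composable paths both bracketings give the union of [A], [g.B] and [gh.C], and are nonzero
    exactly when it has no fork: fork-freeness passes to parts and to translates. *)
Lemma kmulA a b c : pconf a -> pconf b -> pconf c ->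
  obind (kmul a) (kmul b c) = obind (kmul^~ c) (kmul a b).
Proof.
move: a b c => [A g] [B h] [C k] [/= cA Ag] [/= cB Bh] [/= cC Ck].
have [rg sg] := conf_path cA Ag; have [rh sh] := conf_path cB Bh.
have E : (A `|` tr g (B `|` tr h C) = (A `|` tr g B) `|` tr (pathM g h) C)%classic.
  by rewrite trU trM setUA.
rewrite /kmul /=; case: (asboolP (prng h = psrc k /\ _)) => [[hk fBC]|n1] /=.
  case: asboolP => [[gh fABC]|n2]; case: asboolP => [[gh' fAB]|n3] //=.
  - rewrite E in fABC *; rewrite pathMA; case: asboolP => // -[]; split=> //.
    by rewrite (pathM_rpath rg rh gh).2.
  - by case: n3; split=> //; apply: fork_free_sub fABC; rewrite E; apply: subsetUl.
  - case: asboolP => // -[e fABC]; by case: n2; split=> //; rewrite E.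
case: asboolP => [[gh fAB]|] //=; case: asboolP => // -[ek fABC]; case: n1.
rewrite (pathM_rpath rg rh gh).2 in ek; split=> //.
apply: (@fork_free_trW _ g); apply: fork_free_sub fABC; rewrite -E.
exact: subsetUr.
Qed.

Lemma LM_semigroup0 : semigroup0 (LM G).
Proof.
split=> [x y z|x|x]; last by case: x.
  apply: key_inj; rewrite !keyM.
  case kx : (key x) => [a|] //=; case ky : (key y) => [b|] //=.
  case kz : (key z) => [c|] /=; last by case: (kmul a b).
  exact: kmulA (keyP kx) (keyP ky) (keyP kz).
by [].
Qed.

Lemma kmul1 A g : pconf (A, g) -> kmul (A, vpath (psrc g)) (A, g) = Some (A, g).
Proof.
move=> [/= cA Ag]; have [rg sg] := conf_path cA Ag.
rewrite /kmul /= (tr1 (fun p => @conf_path _ _ _ p cA)) setUid path1M //.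
by case: asboolP => // -[]; split=> //; apply: (conf_ff cA).
Qed.

Lemma kmulV A g : pconf (A, g) ->
  kmul (A, g) (tr (pathV g) A, pathV g) = Some (A, vpath (psrc g)).
Proof.
move=> [/= cA Ag]; rewrite /kmul /= (conf_trVK cA Ag) setUid pathMV.
by case: asboolP => // -[]; split=> //; apply: (conf_ff cA).
Qed.

Lemma pconfV A g : pconf (A, g) -> pconf (tr (pathV g) A, pathV g).
Proof. by move=> [/= cA Ag]; split; [exact: conf_trV cA Ag|exact: conf_trVV cA Ag]. Qed.

Lemma key_inverse x y A g : key x = Some (A, g) ->
  key y = Some (tr (pathV g) A, pathV g) -> is_inverse x y.
Proof.
(* One identity suffices: translating [g^-1 . A] back by [g] gives [A], so the situation is
   symmetric. *)
have half x' y' A' g' : key x' = Some (A', g') ->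
    key y' = Some (tr (pathV g') A', pathV g') -> x' * y' * x' = x'.
  move=> kx ky; have cA := keyP kx; apply: key_inj; rewrite kx.
  rewrite -(kmul1 cA); apply: keyM_some => //.
  by rewrite (keyM_some kx ky) kmulV.
move=> kx ky; have [cA Ag] := keyP kx; have [rg sg] := conf_path cA Ag.
split; first exact: half kx ky.
by apply: half ky _; rewrite pathVK // (conf_trVK cA Ag).
Qed.

Lemma LM_regular x : exists y, is_inverse x y.
Proof.
case kx : (key x) => [[A g]|]; last first.
  by rewrite (key_none kx); exists null.
have [y ky] := key_ex (pconfV (keyP kx)); exists y; exact: key_inverse kx ky.
Qed.

Lemma LM_idem x : x * x = x <->
  x = null \/ exists A v, key x = Some (A, vpath v).
Proof.
split=> [xx|[->//|[A [v kx]]]]; last first.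
  by apply: key_inj; rewrite (keyM_some kx kx) (kmul1 (keyP kx)) kx.
case kx : (key x) => [[A g]|]; last by left; apply: key_none.
right; exists A, (psrc g); have [cA Ag] := keyP kx; have [rg sg] := conf_path cA Ag.
have := keyM_some kx kx; rewrite xx kx /kmul; case: asboolP => //= _ [_ gg].
suff {1}-> : g = vpath (psrc g) by [].
(* The only idempotent of a group is [1], and [omega] is injective on paths with a given source. *)
apply: (omega_inj rg) => //; apply: (@mulgI _ (omega g)).
by rewrite -omegaM -gg omega_vpath mulg1.
Qed.

Lemma LM_idem_comm x y : x * x = x -> y * y = y -> x * y = y * x.
Proof.
move=> /LM_idem[->|[A [v kx]]] /LM_idem[->|[B [u ky]]] //.
- by have [_ _ h] := LM_semigroup0; rewrite h.
- by have [_ _ h] := LM_semigroup0; rewrite h.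
have [cA _] := keyP kx; have [cB _] := keyP ky.
apply: key_inj; rewrite (keyM_some kx ky) (keyM_some ky kx).
have [uv|uv] := pselect (u = v); last first.
  by rewrite /kmul; case: asboolP => [[/= /esym/uv]|_] //; case: asboolP => [[/= /uv]|_].
rewrite uv in cB *; rewrite /kmul /= (tr1 (fun p => @conf_path _ _ _ p cA)) (tr1 (fun p => @conf_path _ _ _ p cB)).
by rewrite (setUC A).
Qed.

Lemma LM_inverse_semigroup0 : inverse_semigroup0 (LM G).
Proof.
exact: inverse_semigroup0I LM_semigroup0 LM_regular LM_idem_comm.
Qed.

Lemma LM_omega_key x A g : key x = Some (A, g) -> LM_omega x = omega g.
Proof. by case: x => // t [_ <-]. Qed.

Lemma LM_omegaM x y : x * y <> null -> LM_omega (x * y) = LM_omega x * LM_omega y.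
Proof.
case kx : (key x) => [[A g]|]; last by rewrite (key_none kx).
case ky : (key y) => [[B h]|]; last first.
  by rewrite (key_none ky); have [_ _ z] := LM_semigroup0; rewrite z.
have := keyM_some kx ky; rewrite /kmul; case: asboolP => _ kxy xy0.
  by rewrite (LM_omega_key kxy) omegaM (LM_omega_key kx) (LM_omega_key ky).
by case: xy0; apply: key_none.
Qed.

Lemma LM_omega_pure x : x <> null -> (LM_omega x = 1 <-> x * x = x).
Proof.
move=> x0; split=> [|/LM_idem[//|[A [v kx]]]]; last first.
  by rewrite (LM_omega_key kx) omega_vpath.
case kx : (key x) => [[A g]|]; last by case: x0; apply: key_none.
rewrite (LM_omega_key kx) => g1; apply/LM_idem; right; exists A, (psrc g).
have [cA Ag] := keyP kx; have [rg sg] := conf_path cA Ag.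
by rewrite kx -(omega_inj rg (rpath_vpath (psrc g))) // g1 omega_vpath.
Qed.

Lemma toLM_inverse T T' g : is_LM (T, g) -> representative T T' -> g \in T' ->
  let t := (TL (translate (pathV g) T'), pathV g) in
  is_LM t /\ is_inverse (toLM (T, g)) (toLM t).
Proof.
move=> LT RT gT' /=; have [XLT sg] := (is_LMP T g).1 LT.
have [XT' sT'] := (representativeP _ XLT).1 RT.
have [XV sV] := X_at_translateV XT' gT'; rewrite sT' in sV.
have rV := X_at_rooted XV.
have Lt : is_LM (TL (translate (pathV g) T'), pathV g).
  apply/is_LMP; split; first exact: X_L_TL.
  rewrite (sat_TL rV) sV; have [cA Ag] := keyP (key_toLM LT).
  exact: conf_trVV cA Ag.
split=> //; apply: key_inverse (key_toLM LT) _.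
by rewrite key_toLM // /skey /= (sat_TL rV) sV.
Qed.

End LeavittMunnTrees.

(** * The Leavitt generators as Leavitt-Munn trees *)

Section LeavittToMunn.
Variable G : sepgraph.
Local Notation gp := (gpath G).
Implicit Types (p q r g h : gp) (v : vertex G) (w : seq (hedge G)) (x : hedge G).
Implicit Types (T S : {fset gp}) (A B : set gp).

Definition psat p : set gp := sat (pref_down [fset p]%fset).

Definition gen_path (c : LI_gen G) : gp :=
  match c with inl v => vpath v | inr x => (hsrc x, [:: x]) end.

Lemma gen_path_FC c : FC (gen_path c).
Proof. by case: c => [v|x] //; rewrite /FC /is_path /= eqxx. Qed.

Definition munn_gen (c : LI_gen G) : LM G :=
  toLM (TL (pref_down [fset gen_path c]%fset), gen_path c).

Lemma key_munn_gen c : key (munn_gen c) = Some (psat (gen_path c), gen_path c).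
Proof.
have Fc := gen_path_FC c; have rT := X_at_rooted (X_at_down1 Fc).
rewrite key_toLM /skey /= ?(sat_TL rT) //; apply/is_LMP; split.
  exact: X_L_TL (X_at_down1 Fc).
by rewrite (sat_TL rT); apply: (sub_sat rT); rewrite down1P le_pref_refl.
Qed.

Lemma psat_self p : rpath p -> psat p p.
Proof.
by move=> rp; apply: (sub_sat (rooted_down1 rp)); rewrite down1P le_pref_refl.
Qed.

Lemma psatP p q : rpath p -> psat p q <-> rpath q /\ le_pref (pL q) p.
Proof. by move=> rp; rewrite -down1P; apply: (satP q (rooted_down1 rp)). Qed.

Lemma pconf_psat p : FC p -> pconf (psat p, p).
Proof. by move=> Fp; split; [exact: conf_down1|apply: psat_self (FC_rpath Fp)]. Qed.

Lemma FC_catr v a b : FC (v, a ++ b) -> FC (pend v a, b).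
Proof.
rewrite /FC /is_path /= path_from_cat => /and3P[/andP[_ ->] /reduced_catr ->] /=.
by rewrite /Cseparated; case: a => //= x a; rewrite cat_path => /andP[_ /path_sorted].
Qed.

(** The prefixes of [ab] are those of [a] together with [a] followed by those of [b]. *)
Lemma psat_cat v a b : rpath (v, a ++ b) ->
  (psat (v, a) `|` tr (v, a) (psat (pend v a, b)))%classic = psat (v, a ++ b).
Proof.
move=> rab; have /andP[pab redab] := rab.
have ra : rpath (v, a).
  by apply: rpath_prefix rab; rewrite /le_pref /= eqxx prefix_prefix.
have rb : rpath (pend v a, b).
  by move: pab redab; rewrite /rpath /is_path /= path_from_cat => /andP[_ ->] /reduced_catr.
rewrite /psat -(sat_translate (G := G) ra (rooted_down1 rb)) -satU; congr sat.
apply/fsetP => u; rewrite down1P inE down1P; apply/orP/idP.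
  case=> [|/translateP[[v' b']]].
    move=> /andP[/eqP u1 ua]; rewrite /le_pref /= u1 eqxx.
    exact: prefix_trans ua (prefix_prefix _ _).
  rewrite down1P => /andP[_ /= b'b] ->; rewrite /le_pref /= eqxx /= red_id.
    by rewrite prefix_catr ?eqxx.
  by apply: reduced_prefix redab; rewrite /= prefix_catr ?eqxx.
move=> /andP[/= /eqP u1 uab]; rewrite -[a ++ b](red_id redab) in uab.
have [|ua|[b' b'b uE]] := prefix_red _ uab; first by case/andP: ra.
  by left; rewrite /le_pref /= u1 eqxx.
right; apply/translateP; exists (pend v a, b'); first by rewrite down1P /le_pref eqxx.
by rewrite (surjective_pairing u) u1 uE.
Qed.

Lemma kmul_cat v a b : FC (v, a ++ b) ->
  kmul (psat (v, a), (v, a)) (psat (pend v a, b), (pend v a, b)) =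
  Some (psat (v, a ++ b), (v, a ++ b)).
Proof.
move=> Fab; have rab := FC_rpath Fab; rewrite /kmul /= psat_cat //.
rewrite /pathM /= red_id; last by case/andP: rab.
by case: asboolP => // -[]; split=> //; apply: (conf_ff (conf_down1 Fab)).
Qed.

(** The prefixes of [p] form a segment; translation by [p^-1] looks at it from its other end. *)
Lemma psatV p : rpath p -> tr (pathV p) (psat p) = psat (pathV p).
Proof.
move=> rp; have [rV gV] := pathV_rpath rp.
rewrite /psat -sat_translate //; last by rewrite gV; apply: rooted_down1.
congr sat; apply/fsetP => u; rewrite down1P; apply/translateP/idP.
  move=> [q]; rewrite down1P => /andP[/eqP _ /prefixP[c pE]] ->.
  rewrite /le_pref eqxx /= pE winv_cat -catA -red_catr red_winvl cats0 red_id.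
    exact: prefix_prefix.
  by case/andP: rp => _; rewrite pE => /reduced_catr/reduced_winv.
move=> /andP[/eqP u1 /prefixP[z uz]]; exists (p.1, winv z).
  by rewrite down1P /le_pref eqxx /= -{1}(winvK p.2) [winv p.2]uz winv_cat prefix_prefix.
rewrite /pathM /= (surjective_pairing u) u1 /= [winv p.2]uz -catA -red_catr red_winvr cats0.
by rewrite red_id //; move: rV => /andP[_ /=]; rewrite [winv p.2]uz => /reduced_catl.
Qed.

Lemma kmul_psatV p : FC p ->
  kmul (psat p, p) (psat (pathV p), pathV p) = Some (psat p, vpath (psrc p)).
Proof.
move=> Fp; rewrite -psatV; last exact: FC_rpath.
exact: kmulV (pconf_psat Fp).
Qed.

(** The reason why [e^-1 e = r(e)] and, for a singleton block, [e e^-1 = s(e)] hold for trees: such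
    a letter adds nothing to the saturation of its source. *)
Lemma psat_gen x : Lletter x -> psat (hsrc x, [:: x]) = psat (vpath (hsrc x)).
Proof. exact: (@sat_down_rcons _ _ [::] x (FC_rpath (gen_path_FC (inr x)))). Qed.

Lemma pathV_gen x : pathV (gen_path (inr x)) = gen_path (inr (linv x)).
Proof. by rewrite /pathV /= /prng /= hsrc_linv. Qed.

Lemma munn_family : LI_family munn_gen.
Proof.
have gM c d o : kmul (psat (gen_path c), gen_path c) (psat (gen_path d), gen_path d) =
    key o -> munn_gen c * munn_gen d = o.
  by rewrite -(keyM_some (key_munn_gen c) (key_munn_gen d)) => /key_inj.
have genV x : Lletter x ->
    munn_gen (inr x) * munn_gen (inr (linv x)) = munn_gen (inl (hsrc x)).
  move=> Lx; apply: gM; rewrite key_munn_gen -pathV_gen.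
  by rewrite (kmul_psatV (gen_path_FC (inr x))) /= psat_gen.
split=> [v w|x|x|X e f CX Xe Xf|e Ce].
- apply: gM; case: eqP => [<-|vw].
    by rewrite key_munn_gen; apply: kmul1 (pconf_psat (gen_path_FC (inl v))).
  by rewrite /kmul asboolF // => -[/vw].
- apply: gM; rewrite key_munn_gen; apply: (@kmul_cat _ [::]).
  exact: gen_path_FC (inr x).
- apply: gM; rewrite key_munn_gen; apply: (@kmul_cat _ [:: x] [::]).
  exact: gen_path_FC (inr x).
- case: eqP => [<-|ef]; first by rewrite (genV (inr e)).
  apply: gM; rewrite /kmul asboolF // => -[_ fU].
  (* A fork based at [e^-1]: the step by [e] returns to the root, the step by [f] reaches the
     translated generator. *)
  case: ef; apply: (fU (erng e, [:: inr e]) X) => //.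
    left; rewrite /pstep /= eqxx; apply: (sat_vpath (v := erng e)).
    exact: rooted_down1 (FC_rpath (gen_path_FC (inr (inr e)))).
  right; exists (gen_path (inr (inl f))); last by rewrite /pathM /pstep.
  exact: psat_self (FC_rpath (gen_path_FC (inr (inl f)))).
- by apply: (genV (inl e)); apply/asboolP.
Qed.

End LeavittToMunn.

(** * Normal forms in the Leavitt inverse semigroup *)

Section LeavittNormalForm.
Variable G : sepgraph.
Local Notation gp := (gpath G).
Local Notation inv := (@LI_invf G).
Implicit Types (p q r g h : gp) (v : vertex G) (w : seq (hedge G)) (x y : hedge G).
Implicit Types (s t u : LI G) (T : {fset gp}) (l : seq gp).

Let V v : LI G := LI_of (inl v).
Let L x : LI G := LI_of (inr x).

Lemma LI_mulA : associative (@mul (LI G)).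
Proof. by have [] := LI_semigroup0 G. Qed.

Lemma LI_mul0l s : null * s = null.
Proof. by have [_ h _] := LI_semigroup0 G; apply: h. Qed.

Lemma LI_mul0r s : s * null = null.
Proof. by have [_ _ h] := LI_semigroup0 G; apply: h. Qed.

Lemma LI_inverse_uniq s t u : is_inverse s t -> is_inverse s u -> t = u.
Proof.
have [_ U] := LI_inverse_semigroup0 G; have [i [_ iU]] := U s.
by move=> /iU <- /iU <-.
Qed.

Lemma LI_invP s : is_inverse s (inv s).
Proof. by split; [apply: LI_mulVf|have := LI_mulVf (inv s); rewrite LI_invfK]. Qed.

Lemma LI_idemC s t : s * s = s -> t * t = t -> s * t = t * s.
Proof. exact: idempotents_commute (LI_inverse_semigroup0 G) s t. Qed.

Lemma LI_rangeI s : s * inv s * (s * inv s) = s * inv s.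
Proof. by rewrite LI_mulA LI_mulVf. Qed.

Lemma LI_sourceI s : inv s * s * (inv s * s) = inv s * s.
Proof. by have := LI_rangeI (inv s); rewrite LI_invfK. Qed.

Lemma LI_invM s t : inv (s * t) = inv t * inv s.
Proof.
apply: (LI_inverse_uniq (LI_invP _)).
have half a b : a * b * (inv b * inv a) * (a * b) = a * b.
  transitivity (a * (b * inv b * (inv a * a)) * b); first by rewrite !LI_mulA.
  rewrite (LI_idemC (LI_rangeI b) (LI_sourceI a)) !LI_mulA LI_mulVf.
  by rewrite -(LI_mulA a b) -(LI_mulA a) LI_mulVf.
split; first exact: half.
by have := half (inv t) (inv s); rewrite !LI_invfK.
Qed.

Let VV v : V v * V v = V v.
Proof. by rewrite (LI_fam1 (LI_of_family G)) eqxx. Qed.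

Let VV0 v v' : v <> v' -> V v * V v' = null.
Proof. by move=> /eqP/negPf vv; rewrite (LI_fam1 (LI_of_family G)) vv. Qed.

Let VL x : V (hsrc x) * L x = L x. Proof. exact: LI_fam2 (LI_of_family G) x. Qed.

Let LV x : L x * V (hrng x) = L x. Proof. exact: LI_fam3 (LI_of_family G) x. Qed.

(** For [e^-1] this is the block relation with two equal edges; the partition provides a block
    containing [e]. *)
Lemma LI_LK x : Lletter x -> L x * L (linv x) = V (hsrc x).
Proof.
case: x => [e /asboolP Ce|e _]; first exact: LI_fam5 (LI_of_family G) e Ce.
have [+ _ _] := blocksP (esrc e) => /seteqP[_ /(_ e erefl)] [X CX Xe].
have CX' : in_blocks X by exists (esrc e).
by rewrite [LHS](LI_fam4 (LI_of_family G) CX' Xe Xe) eqxx.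
Qed.

Lemma LI_invV v : inv (V v) = V v.
Proof. by apply: (LI_inverse_uniq (LI_invP _)); split; rewrite !VV. Qed.

Lemma LI_invL x : inv (L x) = L (linv x).
Proof.
have half y : L y * L (linv y) * L y = L y.
  case: y => e; last by rewrite LI_LK // VL.
  by rewrite -LI_mulA (LI_LK (x := inr e)) // (LV (inl e)).
apply: (LI_inverse_uniq (LI_invP _)); split; first exact: half.
by have := half (linv x); rewrite linvK.
Qed.

Fixpoint pprod v w : LI G := if w is x :: w' then L x * pprod (hrng x) w' else V v.

Definition LI_path p : LI G := pprod p.1 p.2.

Definition LI_range p : LI G := LI_path p * inv (LI_path p).

Lemma LI_pathE v x w : LI_path (v, x :: w) = L x * LI_path (hrng x, w).
Proof. by []. Qed.

Lemma LI_pathV1 p : is_path p -> V (psrc p) * LI_path p = LI_path p.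
Proof.
case: p => v [|x w] /=; first by rewrite VV.
by move=> /andP[/= /eqP xv _]; rewrite LI_pathE LI_mulA -[V _]/(V v) -xv VL.
Qed.

Lemma LI_path_cat v a b : path_from v (a ++ b) ->
  LI_path (v, a ++ b) = LI_path (v, a) * LI_path (pend v a, b).
Proof.
elim: a v => [|x a IH] v /=; first by move=> pb; rewrite (LI_pathV1 (p := (v, b))).
by move=> /andP[_ /IH IHE]; rewrite !LI_pathE IHE LI_mulA.
Qed.

Lemma LI_rangeII p : LI_range p * LI_range p = LI_range p.
Proof. exact: LI_rangeI. Qed.

Lemma LI_rangeC p q : LI_range p * LI_range q = LI_range q * LI_range p.
Proof. by apply: LI_idemC; apply: LI_rangeII. Qed.

Lemma LI_range_path p : LI_range p * LI_path p = LI_path p.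
Proof. exact: LI_mulVf. Qed.

Lemma LI_range_prefix p q : is_path p -> le_pref q p ->
  LI_range q * LI_range p = LI_range p.
Proof.
case: p q => [v w] [v' a] pab /andP[/= /eqP-> /prefixP[b /= wE]].
rewrite {w}wE in pab *.
by rewrite {2 3}/LI_range (LI_path_cat pab) !LI_mulA LI_range_path.
Qed.

(** For such a letter [x x^-1] is a vertex and drops out of [w x x^-1 w^-1]: the counterpart in LI
    of the generators of [simL]. *)
Lemma LI_range_rconsL v w x : path_from v (rcons w x) -> Lletter x ->
  LI_range (v, rcons w x) = LI_range (v, w).
Proof.
rewrite path_from_rcons -cats1 => /andP[pw /eqP xw] Lx; rewrite /LI_range LI_path_cat.
  rewrite LI_pathE LV LI_invM LI_invL LI_mulA -(LI_mulA _ (L x)) LI_LK // xw.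
  rewrite -[V _]/(LI_path (pend v w, [::])) -LI_path_cat ?cats0 //.
by rewrite path_from_cat pw /= xw eqxx.
Qed.

Lemma LI_range_pL p : is_path p -> LI_range (pL p) = LI_range p.
Proof.
case: p => v w; elim/last_ind: w => [//|w x IH] pwx.
have [Lx|Lx] := boolP (Lletter x); rewrite /pL /=; last by rewrite strip_rconsN.
rewrite strip_rconsL // LI_range_rconsL //; apply: IH.
by move: pwx; rewrite /is_path /= path_from_rcons => /andP[].
Qed.

Definition lpath x : gp := (hsrc x, [:: x]).

Lemma lpathM x p : rpath p -> hrng x = psrc p -> 
  (exists2 w, p = (hrng x, linv x :: w) & pathM (lpath x) p = (hsrc x, w)) \/
  pathM (lpath x) p = (hsrc x, x :: p.2).
Proof.
move=> /andP[_ rp] xp; rewrite /pathM /= red_id //.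
case: p rp xp => v [|y w] rp /= <-; first by right.
by case: (y =P linv x) => [->|_]; [left; exists w|right].
Qed.

(** If [p = x^-1 w] cancels, it suffices to commute [x x^-1] with [w w^-1]; otherwise [p p^-1] is
    commuted past [x^-1 x]. *)
Lemma LI_letter_range x p : rpath p -> hrng x = psrc p ->
  L x * LI_range p = LI_range (pathM (lpath x) p) * L x.
Proof.
move=> rp xp; have [[w pE ->]|->] := lpathM rp xp.
  transitivity (L x * inv (L x) * LI_range (hsrc x, w) * L x).
    by rewrite pE /LI_range LI_pathE hrng_linv LI_invM !LI_invL linvK !LI_mulA.
  by rewrite (LI_idemC (LI_rangeI (L x)) (LI_rangeII _)) -LI_mulA LI_mulVf.
rewrite /LI_range !LI_pathE LI_invM xp -surjective_pairing.
set m := LI_path p; transitivity (L x * (m * inv m * (inv (L x) * L x))).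
  rewrite (LI_idemC (LI_rangeI m) (LI_sourceI (L x))) [RHS]LI_mulA.
  by rewrite (LI_mulA (L x) _ (L x)) LI_mulVf.
by rewrite !LI_mulA.
Qed.

(** Unlike for ranges, a cancellation leaves a trace: [x x^-1 w] is [w] only up to the idempotent
    [x x^-1]. This is why normal forms carry a list of ranges. *)
Lemma LI_letter_path x p : rpath p -> hrng x = psrc p ->
  L x * LI_path p = LI_range (lpath x) * LI_path (pathM (lpath x) p).
Proof.
move=> rp xp; rewrite {1}/LI_range LI_pathE /= -/(V _) LV.
have [[w pE ->]|->] := lpathM rp xp.
  by rewrite pE LI_pathE hrng_linv LI_mulA LI_invL.
by rewrite LI_pathE xp -surjective_pairing LI_mulA LI_mulVf.
Qed.

Lemma lpath_rpath x : rpath (lpath x).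
Proof. by rewrite /rpath /is_path /= eqxx. Qed.

Lemma LI_path_range q p : rpath q -> rpath p -> prng q = psrc p ->
  LI_path q * LI_range p = LI_range (pathM q p) * LI_path q.
Proof.
case: q => v w; elim: w v => [|x w IH] v rq rp qp.
  have vp : psrc p = v by rewrite -qp.
  have [pp _] := andP rp; have h := LI_pathV1 pp; rewrite vp in h.
  rewrite -/(vpath v) path1M //.
  rewrite -[LI_path _]/(V v) /LI_range !LI_mulA h.
  by rewrite -LI_mulA -(LI_invV v) -LI_invM h.
have rw : rpath (hrng x, w).
  by move: rq; rewrite /rpath /is_path /= => /andP[/andP[_ ->] /path_sorted].
have xv : hsrc x = v by move: rq => /andP[/andP[/eqP]].
have [rwp wpr] := pathM_rpath rw rp qp.
rewrite LI_pathE -LI_mulA (IH _ rw rp qp) LI_mulA LI_letter_range //.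
rewrite pathMA -LI_mulA; congr (LI_range (pathM _ _) * _).
rewrite /lpath xv /pathM [red _](@red_id _ (x :: w)) //.
by case/andP: rq.
Qed.

(** Conjugation by [p] reduces the fork to the edges themselves, where [e e^-1 f f^-1] vanishes
    because [e^-1 f] does. *)
Lemma LI_range_fork p (X : set (edge G)) e f : in_blocks X -> X e -> X f -> e <> f ->
  rpath (pstep p (inl e)) -> rpath (pstep p (inl f)) ->
  LI_range (pstep p (inl e)) * LI_range (pstep p (inl f)) = null.
Proof.
move=> CX Xe Xf ef; rewrite -pstep_red -[pstep p (inl f)]pstep_red.
have : reduced (p.1, red p.2).2 by apply: red_reduced.
move: (p.1, red p.2) => {}p rp.
(* Ranges commute, so [f] may be chosen as a step that extends [p]; both steps cannot cancel. *)
wlog ext : e f Xe Xf ef / red (rcons p.2 (inl f)) = rcons p.2 (inl f).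
  move=> H re rf; have [[w [pE _]]|] := red_rcons (inl f) rp; last by move=> h; apply: H.
  have [[w' [pE' _]]|h] := red_rcons (inl e) rp.
    by move: pE'; rewrite pE => /rcons_inj[_ [/esym/ef]].
  by rewrite LI_rangeC; apply: H => //; apply: nesym.
move=> re rf; have [pp fp] : path_from p.1 p.2 /\ esrc f = prng p.
  have /andP[] := rf; rewrite /is_path /pstep ext /= path_from_rcons.
  by move=> /andP[-> /eqP].
have rpp : rpath p by rewrite /rpath /is_path pp rp.
have stepE a : esrc a = prng p -> LI_path p * LI_range (lpath (inl a)) =
    LI_range (pstep p (inl a)) * LI_path p.
  move=> ap; rewrite LI_path_range ?lpath_rpath //.
  by rewrite /pathM /= cats1.
have ep : esrc e = prng p by rewrite (block_esrc CX Xe Xf).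
have pf : le_pref p (pstep p (inl f)) by rewrite /le_pref eqxx /= ext prefix_rcons.
(* The range of the prefix [p] is inserted; its two factors carry out the conjugation. *)
rewrite -(LI_range_prefix _ pf); last by case/andP: rf.
have E : LI_range (pstep p (inl e)) * LI_range (pstep p (inl f)) * LI_path p =
    LI_path p * (LI_range (lpath (inl e)) * LI_range (lpath (inl f))).
  by rewrite -LI_mulA -stepE // LI_mulA -stepE // -LI_mulA.
rewrite (LI_rangeC p).
transitivity (LI_range (pstep p (inl e)) * LI_range (pstep p (inl f)) * LI_path p
  * inv (LI_path p)); first by rewrite !LI_mulA.
rewrite E.
suff -> : LI_range (lpath (inl e)) * LI_range (lpath (inl f)) = null.
  by rewrite LI_mul0r LI_mul0l.
rewrite /LI_range /LI_path /= -!/(V _) !LV !LI_invL LI_mulA -(LI_mulA (L (inl e))).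
rewrite [L _ * L (inl f)](LI_fam4 (LI_of_family G) CX Xe Xf).
by move/eqP/negPf: ef => ->; rewrite LI_mul0r LI_mul0l.
Qed.

(** * Products of range idempotents and normal forms *)

Definition LI_ranges l t : LI G := foldr (fun p s => LI_range p * s) t l.

Lemma LI_rangeCA p q t :
  LI_range p * (LI_range q * t) = LI_range q * (LI_range p * t).
Proof.
by rewrite (LI_mulA (LI_range p) (LI_range q)) LI_rangeC -(LI_mulA (LI_range q) (LI_range p)).
Qed.

Lemma LI_rangesC p l t : LI_range p * LI_ranges l t = LI_ranges l (LI_range p * t).
Proof. by elim: l => //= q l <-; rewrite LI_rangeCA. Qed.

Lemma LI_ranges_comm l1 l2 t : LI_ranges l1 (LI_ranges l2 t) = LI_ranges l2 (LI_ranges l1 t).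
Proof. by elim: l1 => //= p l1 ->; rewrite LI_rangesC. Qed.

Lemma LI_ranges_absorb l t : (forall p, p \in l -> LI_range p * t = t) -> LI_ranges l t = t.
Proof.
elim: l => //= p l IH lt; rewrite IH; first by apply: lt; rewrite inE eqxx.
by move=> q ql; apply: lt; rewrite inE ql orbT.
Qed.

Lemma LI_range_ranges p l t : p \in l -> LI_range p * LI_ranges l t = LI_ranges l t.
Proof.
elim: l => //= q l IH; rewrite inE => /orP[/eqP<-|/IH E].
  by rewrite (LI_mulA (LI_range p) (LI_range p)) LI_rangeII.
by rewrite LI_rangeCA E.
Qed.

Definition normal_form s : Prop := s = null \/ exists g l,
  [/\ rpath g, forall p, p \in l -> rpath p /\ psrc p = psrc g
    & s = LI_ranges l (LI_path g)].

Lemma LI_ranges_V1 g l : rpath g -> (forall p, p \in l -> rpath p /\ psrc p = psrc g) ->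
  V (psrc g) * LI_ranges l (LI_path g) = LI_ranges l (LI_path g).
Proof.
move=> /andP[pg _]; case: l => [_|p l lP] /=; first exact: LI_pathV1.
have [/andP[pp _] <-] := lP p (mem_head _ _).
transitivity (V (psrc p) * LI_path p * inv (LI_path p) * LI_ranges l (LI_path g)).
  by rewrite !LI_mulA.
by rewrite LI_pathV1.
Qed.

Lemma normal_form_V v s : normal_form s -> normal_form (V v * s).
Proof.
move=> [->|[g [l [rg lP ->]]]]; first by left; rewrite LI_mul0r.
have [->|vg] := pselect (v = psrc g).
  by right; exists g, l; rewrite LI_ranges_V1.
by left; rewrite -(LI_ranges_V1 rg lP) LI_mulA VV0 // LI_mul0l.
Qed.

Lemma LI_letter_ranges x g l : hrng x = psrc g ->
  (forall p, p \in l -> rpath p /\ psrc p = psrc g) ->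
  L x * LI_ranges l (LI_path g) =
  LI_ranges (map (pathM (lpath x)) l) (L x * LI_path g).
Proof.
move=> xg; elim: l => //= p l IH lP; have [rp pg] := lP p (mem_head _ _).
rewrite -IH; last by move=> q ql; apply: lP; rewrite inE ql orbT.
by rewrite (LI_mulA (L x)) LI_letter_range ?pg // -(LI_mulA (LI_range _)).
Qed.

Lemma normal_form_L x s : normal_form s -> normal_form (L x * s).
Proof.
move=> [->|[g [l [rg lP ->]]]]; first by left; rewrite LI_mul0r.
have [xg|xg] := pselect (hrng x = psrc g); last first.
  by left; rewrite -(LI_ranges_V1 rg lP) -(LV x) -LI_mulA (LI_mulA (V _)) VV0 // LI_mul0l LI_mul0r.
(* The added range of [x] accounts for a possible cancellation in [x . g]. *)
right; exists (pathM (lpath x) g), (rcons (map (pathM (lpath x)) l) (lpath x)).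
split; first by have [] := pathM_rpath (lpath_rpath x) rg xg.
  move=> p; rewrite mem_rcons inE => /orP[/eqP->|/mapP[q /lP[rq qg] ->]].
    by split=> //; apply: lpath_rpath.
  by split=> //; apply: (pathM_rpath (lpath_rpath x) rq (etrans xg (esym qg))).1.
by rewrite LI_letter_ranges // LI_letter_path // /LI_ranges -cats1 foldr_cat.
Qed.

Lemma normal_formP s : normal_form s.
Proof.
(* The induction on terms needs stability under left multiplication to treat products, and the same
   for [inv u] to treat formal inverses. *)
pose W u := normal_form u /\ forall s, normal_form s -> normal_form (u * s).
pose P u := W u /\ W (inv u).
suff H : forall t : LI_term G, P (toLI t).
  by elim/LI_ind_term: s => t; have [[]] := H t.
have WV v : W (V v).
  split; last exact: normal_form_V.
  by right; exists (vpath v), [::].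
have WL x : W (L x).
  split; last exact: normal_form_L.
  right; exists (lpath x), [::]; rewrite lpath_rpath; split=> //=.
  by rewrite /LI_path /= -/(V _) LV.
have WM a b : W a -> W b -> W (a * b).
  move=> [_ Wa] [nb Wb]; split=> [|u nu]; first exact: Wa.
  by rewrite -LI_mulA; apply/Wa/Wb.
have W0 : W null by split=> [|u _]; left; rewrite ?LI_mul0l.
elim=> [[v|x]||t1 [W1 V1] t2 [W2 V2]|t1 [W1 V1]].
- by split; [exact: WV|change (W (inv (V v))); rewrite LI_invV; exact: WV].
- by split; [exact: WL|change (W (inv (L x))); rewrite LI_invL; exact: WL].
- split=> //; suff -> : inv (toLI (tzero G)) = null by [].
  by rewrite -[LHS](LI_invP null).2 LI_mul0r LI_mul0l.
- by rewrite toLI_mul; split; [|rewrite LI_invM]; apply: WM.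
- by rewrite -toLI_inv; split; rewrite ?LI_invfK.
Qed.

Lemma LI_ranges_fork T t v : rooted v T -> ~ fork_free [set` T] ->
  LI_ranges (enum_fset T) t = null.
Proof.
move=> [_ _ TP] nf; apply: contrapT => n0; apply: nf => p X e f CX Xe Xf /= Te Tf.
apply: contrapT => ef; apply: n0.
rewrite -(LI_range_ranges t Te) -(LI_range_ranges t Tf) LI_mulA.
rewrite (LI_range_fork CX Xe Xf ef) ?LI_mul0l //.
  by have [] := TP _ Te.
by have [] := TP _ Tf.
Qed.

(** Ranges of prefixes may be added freely, as they absorb into those of longer paths; a fork in the
    resulting tree would make [s] zero. *)
Lemma LI_normal s : s <> null -> exists T g,
  [/\ X_at (psrc g) T, g \in T & s = LI_ranges (enum_fset T) (LI_path g)].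
Proof.
have [//|[g [l [rg lP ->]]] n0] := normal_formP s.
pose A := [fset p in g :: l]%fset; pose T := pref_down A.
have AP p : p \in A = (p \in g :: l) by rewrite in_fset.
have rA p : p \in A -> rpath p /\ psrc p = psrc g.
  by rewrite AP inE => /orP[/eqP->|/lP].
have rT : rooted (psrc g) T.
  apply: rooted_down rA; apply/eqP/fset0Pn; exists g.
  by rewrite AP mem_head.
have E : LI_ranges l (LI_path g) = LI_ranges (enum_fset T) (LI_path g).
  transitivity (LI_ranges (enum_fset T) (LI_ranges l (LI_path g))).
    apply/esym/LI_ranges_absorb => p /pref_downP[q]; rewrite AP inE => ql pq.
    have [/andP[pathq _] _] : rpath q /\ psrc q = psrc g by apply: rA; rewrite AP inE.
    suff <- : LI_range q * LI_ranges l (LI_path g) = LI_ranges l (LI_path g).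
      by rewrite LI_mulA (LI_range_prefix pathq pq).
    case/orP: ql => [/eqP->|ql]; last exact: LI_range_ranges.
    by rewrite LI_rangesC LI_range_path.
  rewrite LI_ranges_comm; apply: LI_ranges_absorb => p pl.
  by apply: LI_range_ranges; apply: sub_down; rewrite AP inE pl orbT.
exists T, g; split=> //; last by apply: sub_down; rewrite AP mem_head.
apply/X_atP; split=> //; apply: contrapT => nf; apply: n0.
by rewrite E (LI_ranges_fork _ rT nf).
Qed.

(** Stripping does not change ranges, and the stripped paths of one tree belong to the other; so
    each product absorbs the other. *)
Lemma LI_ranges_sat v T S t : X_at v T -> X_at v S -> sat T = sat S ->
  LI_ranges (enum_fset T) t = LI_ranges (enum_fset S) t.
Proof.
move=> /X_at_rooted rT /X_at_rooted rS TS.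
have half T' S' : rooted v T' -> rooted v S' -> sat T' = sat S' ->
    LI_ranges (enum_fset S') (LI_ranges (enum_fset T') t) = LI_ranges (enum_fset T') t.
  move=> rT' rS' E; apply: LI_ranges_absorb => p pS; have := sub_sat rS' pS.
  rewrite -E => /(satP _ rT')[/andP[pp _] pLT]; rewrite -LI_range_pL //.
  exact: LI_range_ranges.
by rewrite -(half _ _ rT rS TS) LI_ranges_comm half.
Qed.

(** * Images of the normal forms among the Leavitt-Munn trees *)

Section Image.
Variable f : LI G -> LM G.
Hypothesis fM : morphism0 f.
Hypothesis f_gen : forall c, f (LI_of c) = munn_gen c.

Lemma key_path p : FC p -> key (f (LI_path p)) = Some (psat p, p).
Proof.
case: p => v w; elim: w v => [|x w IH] v Fp.
  by rewrite -[LI_path _]/(V v) f_gen key_munn_gen.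
have xv : hsrc x = v by case/and3P: Fp => /andP[/eqP].
have := IH _ (FC_catr (a := [:: x]) Fp); rewrite LI_pathE fM.1 f_gen => kw.
rewrite (keyM_some (key_munn_gen _) kw) /= xv.
exact: (@kmul_cat _ v [:: x] w).
Qed.

Lemma key_range p : FC p -> key (f (LI_range p)) = Some (psat p, vpath (psrc p)).
Proof.
move=> Fp; have kp := key_path Fp; have [y ky] := key_ex (pconfV (pconf_psat Fp)).
have pV : f (inv (LI_path p)) = y.
  have [_ U] := LM_inverse_semigroup0 G; have [i [_ iU]] := U (f (LI_path p)).
  rewrite -(iU y); last exact: key_inverse kp ky.
  by apply/esym/iU; have [h1 h2] := LI_invP (LI_path p); split; rewrite -!fM.1 ?h1 ?h2.
by rewrite fM.1 pV (keyM_some kp ky) (kmulV (pconf_psat Fp)).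
Qed.

Lemma psat_sub v A p : conf v A -> A p -> (psat p `<=` A)%classic.
Proof.
move=> [T /X_at_rooted rT ->] sp; apply: (sat_min rT) => q; rewrite down1P.
exact: sat_prefix rT sp.
Qed.

(** Two bounds on [B] are enough: the upper one keeps every partial product fork-free, hence
    nonzero, and they meet when [l] enumerates a tree with saturation [A]. *)
Lemma key_ranges v A g l : conf v A -> A g -> (forall p, p \in l -> A p) ->
  exists B, [/\ key (f (LI_ranges l (LI_path g))) = Some (B, g), (B `<=` A)%classic
    & forall p, p \in l -> (psat p `<=` B)%classic].
Proof.
move=> cA Ag; elim: l => [_|p l IH lA].
  by exists (psat g); rewrite (key_path (conf_FC cA Ag)); split=> //; apply: psat_sub cA Ag.
have Ap : A p by apply: lA; rewrite mem_head.
have [|B [kB BA lB]] := IH; first by move=> q ql; apply: lA; rewrite inE ql orbT.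
have [/= cB Bg] := keyP kB; have [_ gv] := conf_path cA Ag; have [_ pv] := conf_path cA Ap.
have pA := psat_sub cA Ap.
exists (psat p `|` B)%classic; split.
- rewrite fM.1 (keyM_some (key_range (conf_FC cA Ap)) kB) /kmul /= pv -gv.
  rewrite (tr1 (fun q => @conf_path _ _ _ q cB)) path1M //; last first.
    by have [] := conf_path cA Ag.
  case: asboolP => // -[]; split=> //; apply: fork_free_sub (conf_ff cA).
  by move=> q [/pA|/BA].
- by move=> q [/pA|/BA].
- move=> q; rewrite inE => /orP[/eqP->|/lB qB]; first exact: subsetUl.
  by move=> r /qB; right.
Qed.

Lemma key_normal v T g : X_at v T -> g \in T ->
  key (f (LI_ranges (enum_fset T) (LI_path g))) = Some (sat T, g).
Proof.
move=> XT gT; have rT := X_at_rooted XT.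
have cT : conf v (sat T) by exists T.
have [||B [-> BT TB]] := key_ranges (l := enum_fset T) (g := g) cT.
- exact: sub_sat rT gT.
- by move=> p pT; apply: sub_sat rT pT.
congr (Some (_, g)); apply/seteqP; split=> // p /(satP _ rT)[rp pLT].
apply: (TB _ pLT); have [_ _ TP] := rT; have [rL _] := TP _ pLT.
by apply/psatP => //; split=> //; apply: le_pref_refl.
Qed.

Lemma LI_to_LM_injective : injective f.
Proof.
(* No nonzero element is sent to zero, since its normal form lives on a fork-free tree. *)
have f0 s : s <> null -> exists a, key (f s) = Some a.
  by move=> /LI_normal[T [g [XT gT ->]]]; exists (sat T, g); apply: key_normal XT gT.
move=> s t fst; have [s0|s0] := pselect (s = null).
  have [->//|/f0[a]] := pselect (t = null).
  by rewrite -fst s0 fM.2.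
have [t0|t0] := pselect (t = null).
  by have [a] := f0 _ s0; rewrite fst t0 fM.2.
have [T [g [XT gT sE]]] := LI_normal s0; have [S [h [XS hS tE]]] := LI_normal t0.
have := key_normal XT gT; rewrite -sE fst tE (key_normal XS hS) => -[ST hg].
rewrite sE hg; rewrite hg in XS; exact: LI_ranges_sat XT XS (esym ST).
Qed.

Lemma LI_to_LM_surjective (x : LM G) : exists s, f s = x.
Proof.
case kx : (key x) => [[A g]|]; last first.
  by exists null; rewrite fM.2 (key_none kx).
have [/= cA Ag] := keyP kx; have [T [XT gT AE]] := conf_rep cA Ag.
exists (LI_ranges (enum_fset T) (LI_path g)); apply: key_inj.
by rewrite kx (key_normal XT gT) AE.
Qed.

End Image.

Theorem LI_LM_isomorphism : exists f : LI G -> LM G, isomorphism0 f.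
Proof.
have [f [[fM f_gen] _]] := LI_universal (LM_inverse_semigroup0 G) (munn_family G).
exists f; split=> //; have [h hK] := choice (LI_to_LM_surjective fM f_gen).
by exists h => // s; apply: (LI_to_LM_injective fM f_gen); rewrite hK.
Qed.

End LeavittNormalForm.

(** * The semilattice and the partial action *)

Section SemilatticeY.
Variable G : sepgraph.
Local Notation gp := (gpath G).
Implicit Types (p q r g : gp) (v : vertex G) (h k : free_group (edge G)).
Implicit Types (T S : {fset gp}) (A B : set gp) (y z : Y_L G).

Definition ysat y : set gp := xsat (repr y).

Lemma toY_repr y : toY (repr y) = y.
Proof. by rewrite /toY reprK. Qed.

Lemma ysat_toY (x : Xsl G) : ysat (toY x) = xsat x.
Proof. by apply/simLP/toY_eq; rewrite toY_repr. Qed.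

Lemma ysat_inj : injective ysat.
Proof. by move=> y z yz; rewrite -(toY_repr y) -(toY_repr z); apply/toY_eq/simLP. Qed.

Lemma ysatM y z : ysat (y * z) = smul (ysat y) (ysat z).
Proof. by rewrite [LHS]ysat_toY xsatM. Qed.

Lemma ysat_null : ysat null = set0.
Proof. exact: ysat_toY. Qed.

Lemma ysat_eq0 y : ysat y = set0 -> y = null.
Proof. by rewrite -ysat_null => /ysat_inj. Qed.

Lemma ysat_Yclass v T : X_at v T -> ysat (Yclass T) = sat T.
Proof. by move=> XT; rewrite ysat_toY (xsat_toX XT). Qed.

Lemma ysatP y : y = null \/ exists v, conf v (ysat y).
Proof.
rewrite /ysat -{1}(toY_repr y); case: (repr y) => [t|]; last by left.
by right; have [_ [v Xt]] := toX_val t; exists v, (val t).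
Qed.

Lemma conf_ysat v A : conf v A -> exists y, ysat y = A.
Proof. by move=> [T XT ->]; exists (Yclass T); apply: ysat_Yclass XT. Qed.

Lemma ysat_conf y g : ysat y g -> conf (psrc g) (ysat y).
Proof.
have [->|[v cy] yg] := ysatP y; first by rewrite ysat_null.
by have [_ ->] := conf_path cy yg.
Qed.

Lemma ysat_neq0 y g : ysat y g -> y <> null.
Proof. by move=> yg y0; move: yg; rewrite y0 ysat_null. Qed.

Lemma ysatM_cases y z : y * z = null \/ ysat (y * z) = (ysat y `|` ysat z)%classic.
Proof.
have [|] := pselect (ysat (y * z) = set0).
  by move=> /ysat_eq0; left.
by rewrite ysatM /smul; case: asboolP => // _ _; right.
Qed.

Lemma smul_conf v w A B : conf v A -> conf w B -> smul A B =
  if `[< v = w /\ fork_free (A `|` B)%classic >] then (A `|` B)%classic else set0.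
Proof.
move=> cA cB; rewrite /smul.
case: asboolP => [[u [Au Bu fU]]|nU]; case: asboolP => [[vw fU']|nU'] //.
  by case: nU'; rewrite -(conf_root cA Au) -(conf_root cB Bu).
case: nU; exists v; split=> //; first exact: conf_vpath cA.
by rewrite vw; apply: conf_vpath cB.
Qed.

Lemma Y_mulC : commutative (@mul (Y_L G)).
Proof.
move=> y z; apply: ysat_inj; rewrite !ysatM /smul (setUC (ysat z)).
by congr (if _ then _ else _); apply: asbool_equiv_eq; split=> -[v []]; exists v.
Qed.

Lemma Y_mul0 y : null * y = null.
Proof.
apply: ysat_inj; rewrite ysatM ysat_null /smul.
by case: asboolP => // -[v []].
Qed.

(** The path of a nonzero idempotent tree is a vertex, so pairing a class with its root identifies
    [Y_L] with the idempotents. *)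
Lemma Y_embedding : exists i : Y_L G -> LM G, [/\ morphism0 i, injective i
  & forall x, x * x = x <-> exists y, i y = x].
Proof.
have /choice[i iP] : forall y, exists x, (y = null -> x = null) /\
    forall v, conf v (ysat y) -> key x = Some (ysat y, vpath v).
  move=> y; have [->|[v cy]] := ysatP y.
    by exists null; split=> // v; rewrite ysat_null => /conf_vpath.
  have [x kx] := @key_ex _ (ysat y, vpath v) (conj cy (conf_vpath cy)).
  exists x; split=> [y0|u /conf_vpath/(conf_root cy) -> //].
  by have := conf_vpath cy; rewrite y0 ysat_null.
have i0 : i null = null by apply: (iP null).1.
have iK y v : conf v (ysat y) -> key (i y) = Some (ysat y, vpath v) := (iP y).2 v.
exists i; split.
- split=> // y z; have [_ L0 R0] := LM_semigroup0 G.
  have [->|[v cy]] := ysatP y; first by rewrite Y_mul0 i0 L0.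
  have [->|[w cz]] := ysatP z; first by rewrite Y_mulC Y_mul0 i0 R0.
  apply: key_inj; rewrite (keyM_some (iK _ _ cy) (iK _ _ cz)).
  have yzE := ysatM y z; rewrite (smul_conf cy cz) in yzE.
  have [vw|vw] := pselect (v = w); last first.
    rewrite asboolF in yzE; last by case.
    rewrite /kmul asboolF; last by case.
    by rewrite (ysat_eq0 yzE) i0.
  rewrite -vw in cz yzE *; rewrite /kmul /= (tr1 (fun p => @conf_path _ _ _ p cz)).
  rewrite path1M //; have [fU|nU] := pselect (fork_free (ysat y `|` ysat z)%classic).
    rewrite asboolT // in yzE; rewrite asboolT // -yzE.
    by apply: iK; rewrite yzE; apply: confU.
  rewrite asboolF in yzE; last by case.
  rewrite asboolF; last by case.
  by rewrite (ysat_eq0 yzE) i0.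
- move=> y z; have [->|[v cy]] := ysatP y; have [->|[w cz]] := ysatP z => //.
  + by rewrite i0 => /(congr1 (@key G)); rewrite (iK _ _ cz).
  + by rewrite i0 => /(congr1 (@key G)); rewrite (iK _ _ cy).
  + by move=> /(congr1 (@key G)); rewrite (iK _ _ cy) (iK _ _ cz) => -[/ysat_inj].
- move=> x; split=> [/LM_idem[->|[A [v kx]]]|[y <-]]; first by exists null.
    have [/= cA _] := keyP kx; have [y yA] := conf_ysat cA; exists y.
    by apply: key_inj; rewrite kx -yA; apply: iK; rewrite yA.
  apply/LM_idem; have [->|[v cy]] := ysatP y; first by left.
  by right; exists (ysat y), v; apply: iK.
Qed.

Lemma Y_semilattice0 : semilattice0 (Y_L G).
Proof.
have [i [[iM i0] i_inj iP]] := Y_embedding; have [A _ _] := LM_semigroup0 G.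
split; [split| |].
- by move=> x y z; apply: i_inj; rewrite !iM A.
- exact: Y_mul0.
- by move=> y; rewrite Y_mulC Y_mul0.
- exact: Y_mulC.
- by move=> y; apply: i_inj; rewrite iM; apply/iP; exists y.
Qed.

Definition theta_dom h : set (Y_L G) :=
  [set y | y = null \/ exists2 g, ysat y g & omega g = h]%classic.

(** The translating path [g^-1] has word [h]. At most one [g] qualifies, since all paths of [ysat y]
    share their source; the default [null] provides the value at zero. *)
Definition theta_act h y : Y_L G := xget (null : Y_L G) [set z | exists g,
  [/\ ysat y g, omega g = h^-1 & ysat z = tr (pathV g) (ysat y)]]%classic.

Lemma theta_actE h y g : ysat y g -> omega g = h^-1 ->
  ysat (theta_act h y) = tr (pathV g) (ysat y).
Proof.
move=> yg gh; have cy := ysat_conf yg.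
have [z zE] := conf_ysat (conf_trV cy yg).
have [|g' [yg' gh' ->]] := @xgetPex _ (null : Y_L G) [set z | exists g,
  [/\ ysat y g, omega g = h^-1 & ysat z = tr (pathV g) (ysat y)]]%classic.
  by exists z, g.
congr (tr (pathV _) _); have [rg _] := conf_path cy yg.
have [rg' sg'] := conf_path cy yg'; apply: (omega_inj rg' rg sg').
by rewrite gh gh'.
Qed.

Lemma theta_act_null h : theta_act h null = null.
Proof. by apply: xgetPN => z [g [+ _ _]]; rewrite ysat_null. Qed.

Lemma theta_dom_null h : theta_dom h null. Proof. by left. Qed.

Lemma theta_dom_ideal h y z : theta_dom h y -> theta_dom h (y * z) /\ theta_dom h (z * y).
Proof.
rewrite (Y_mulC z); suff H : theta_dom h y -> theta_dom h (y * z) by move=> /H.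
move=> [->|[g yg gh]]; first by left; rewrite Y_mul0.
have [->|E] := ysatM_cases y z; first by left.
by right; exists g => //; rewrite E; left.
Qed.

Lemma theta_dom1 : theta_dom 1 = [set: Y_L G]%classic.
Proof.
apply/seteqP; split=> // y _; have [->|[v cy]] := ysatP y; first by left.
by right; exists (vpath v); [exact: conf_vpath cy|exact: omega_vpath].
Qed.

Lemma theta_act1 y : theta_act 1 y = y.
Proof.
have [->|[v cy]] := ysatP y; first exact: theta_act_null.
apply: ysat_inj; rewrite (theta_actE (conf_vpath cy)) ?omega_vpath ?invg1 //.
exact: (tr1 (fun p => @conf_path _ _ _ p cy)).
Qed.

(** If [w] lies in the translate of [y] by [u^-1], then [u . w] lies in [y], and translation by its
    inverse is the composite of the two translations. *)
Lemma theta_comp h k y : theta_dom k^-1 y -> theta_dom h^-1 (theta_act k y) ->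
  theta_dom (h * k)^-1 y /\ theta_act (h * k) y = theta_act h (theta_act k y).
Proof.
move=> [-> _|[u yu uk]]; first by rewrite !theta_act_null; split=> //; left.
have cy := ysat_conf yu; have [ru _] := conf_path cy yu.
have E := theta_actE yu uk; have cz := conf_trV cy yu.
move=> [z0|[w zw wh]].
  by have := conf_vpath cz; rewrite -E z0 ysat_null.
have := zw; rewrite E => -[g yg wE]; have [rg sg] := conf_path cy yg.
have gE : g = pathM u w by rewrite -wE pathMA pathMV path1M.
have gh : omega g = (h * k)^-1 by rewrite gE omegaM uk wh invgM.
split; first by right; exists g.
have cz' := ysat_conf zw; have [rw _] := conf_path cz' zw.
have uw : prng u = psrc w by rewrite -wE.
apply: ysat_inj; rewrite (theta_actE yg gh) (theta_actE zw wh) E trM.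
by rewrite gE pathVM.
Qed.

Lemma theta_fun h y : theta_dom h^-1 y -> theta_dom h (theta_act h y).
Proof.
move=> [->|[g yg gh]]; first by rewrite theta_act_null; left.
right; exists (pathV g); last by rewrite omegaV gh invgK.
by rewrite (theta_actE yg gh); apply: conf_trVV (ysat_conf yg) yg.
Qed.

Lemma theta_actK h y : theta_dom h^-1 y -> theta_act h^-1 (theta_act h y) = y.
Proof.
move=> hy; have [|_ <-] := theta_comp hy _ (h := h^-1).
  by rewrite invgK; apply: theta_fun.
by rewrite mulVg theta_act1.
Qed.

Lemma theta_bij h : set_bij (theta_dom h^-1) (theta_dom h) (theta_act h).
Proof.
split=> [y|y z|y hy]; first exact: theta_fun.
  by rewrite !in_setE => hy hz yz; rewrite -(theta_actK hy) yz theta_actK.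
exists (theta_act h^-1 y); first by apply: theta_fun; rewrite invgK.
by have := @theta_actK h^-1 y; rewrite !invgK; apply.
Qed.

Lemma theta_mul h y z : theta_dom h^-1 y -> theta_dom h^-1 z ->
  theta_act h (y * z) = theta_act h y * theta_act h z.
Proof.
move=> [->|[g yg gh]]; first by rewrite Y_mul0 !theta_act_null Y_mul0.
move=> [->|[k zk kh]]; first by rewrite Y_mulC Y_mul0 !theta_act_null Y_mulC Y_mul0.
have cy := ysat_conf yg; have cz := ysat_conf zk.
have [rg _] := conf_path cy yg; have [rk _] := conf_path cz zk.
(* A path with a given word is determined by either end, so the roots agree before translation
   exactly when they agree afterwards; the zero cases therefore match. *)
have gk : psrc g = psrc k <-> prng g = prng k.
  split=> [sgk|rgk]; first by rewrite (omega_inj rg rk sgk) // gh kh.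
  have [rg' gV] := pathV_rpath rg; have [rk' kV] := pathV_rpath rk.
  by rewrite -gV -kV (omega_inj rg' rk' rgk) // !omegaV gh kh.
apply: ysat_inj; rewrite ysatM (theta_actE yg gh) (theta_actE zk kh).
rewrite (smul_conf (conf_trV cy yg) (conf_trV cz zk)).
have yzE := ysatM y z; rewrite (smul_conf cy cz) in yzE.
have [sgk|sgk] := pselect (psrc g = psrc k); last first.
  rewrite asboolF in yzE; last by move=> [].
  rewrite asboolF; last by move=> [/gk].
  by rewrite (ysat_eq0 yzE) theta_act_null ysat_null.
have E := omega_inj rg rk sgk (etrans gh (esym kh)).
rewrite -E in cz zk yzE *; rewrite -trU.
case: asboolP yzE => [[_ fU]|nU] yzE.
  have yzg : ysat (y * z) g by rewrite yzE; left.
  rewrite (theta_actE yzg gh) yzE; case: asboolP => // -[]; split=> //.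
  apply: fork_free_tr fU => p pU; have [_ ->] := pathV_rpath rg.
  by case: pU => h'; [apply: conf_path cy h'|apply: conf_path cz h'].
rewrite (ysat_eq0 yzE) theta_act_null.
by case: asboolP => [[_ /fork_free_trW fU]|_]; [case: nU|rewrite ysat_null].
Qed.

Definition theta : partial_action (free_group (edge G)) (Y_L G) :=
  PartialAction theta_dom_null theta_dom_ideal theta_bij theta_mul theta_dom1
    theta_act1 (fun h k y => @theta_comp h k y).

End SemilatticeY.

(** * The restricted semidirect product *)

Section SemidirectProduct.
Variable G : sepgraph.
Local Notation gp := (gpath G).
Implicit Types (g h : gp) (v : vertex G) (T S : {fset gp}) (A B : set gp).
Implicit Types (x y : LM G) (p q : sdp (theta G)).

(** The word recovers the path once the root of the tree is known, so no information is lost;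
    [insub] never fails here, by [sdp_val_LM]. *)
Definition LM_to_sdp x : sdp (theta G) :=
  if x is Some t then insub (Yclass (val t).1, omega (val t).2) else None.

Lemma sdp_val_inj : injective (@sdp_val _ _ (theta G)).
Proof. by move=> [p|] [q|] //= [] /val_inj ->. Qed.

Lemma sdp_predP a : reflect (exists2 g, ysat a.1 g & omega g = a.2) (sdp_pred (theta G) a).
Proof.
apply: (iffP (asboolP _)) => [[a0 [//|]]|[g ag ga]] //.
by split; [apply: ysat_neq0 ag|right; exists g].
Qed.

Lemma LM_valP x T g : LM_val x = Some (T, g) -> is_LM (T, g) /\ key x = Some (sat T, g).
Proof.
case: x => // t; rewrite /key /LM_val /= => -[tE].
by split; [rewrite -tE; apply: valP|rewrite tE].
Qed.

Lemma key_val x A g : key x = Some (A, g) ->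
  exists T, [/\ LM_val x = Some (T, g), X_L (psrc g) T & A = sat T].
Proof.
case: x => // t; rewrite /key /LM_val /=; case tE : (val t) => [T h] [<- <-].
exists T; split=> //; suff /is_LMP[] : is_LM (T, h) by [].
by rewrite -tE; apply: valP.
Qed.

Lemma sdp_val_LM x T g : LM_val x = Some (T, g) ->
  sdp_val (LM_to_sdp x) = Some (Yclass T, omega g).
Proof.
move=> /[dup] /LM_valP[/is_LMP[/X_LP[XT _] sg] _]; case: x => // t [tE].
rewrite /LM_to_sdp (tE : val t = _) /sdp_val insubT //.
by apply/sdp_predP; exists g => //; rewrite (ysat_Yclass XT).
Qed.

Lemma sdp_val_key x a z g : key x = Some (ysat z, g) -> a = omega g ->
  sdp_val (LM_to_sdp x) = Some (z, a).
Proof.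
move=> /key_val[T [xT /X_LP[XT _] zT]] ->; rewrite (sdp_val_LM xT).
by congr (Some (_, _)); apply: ysat_inj; rewrite (ysat_Yclass XT).
Qed.

Lemma LM_to_sdp_injective : injective LM_to_sdp.
Proof.
move=> x y xy; apply: key_inj.
have some u : (exists T g, LM_val u = Some (T, g)) \/ u = null.
  by case: u => [t|]; [left; exists (val t).1, (val t).2; rewrite -surjective_pairing|right].
have [[T [g xT]]|x0] := some x; have [[S [h yS]]|y0] := some y.
- have := sdp_val_LM xT; rewrite xy (sdp_val_LM yS) => -[ST gh].
  have [/is_LMP[/X_LP[XT _] sg] ->] := LM_valP xT.
  have [/is_LMP[/X_LP[XS _] sh] ->] := LM_valP yS.
  have := congr1 (@ysat G) ST; rewrite (ysat_Yclass XS) (ysat_Yclass XT) => E.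
  rewrite E in sh *; congr (Some (_, _)).
  have [rg _] := sat_rpath (X_at_rooted XT) sg; have [rh hg] := sat_rpath (X_at_rooted XT) sh.
  by apply: omega_inj rg rh (esym hg) _; apply/val_inj/esym.
- by have := sdp_val_LM xT; rewrite xy y0.
- by have := sdp_val_LM yS; rewrite -xy x0.
- by rewrite x0 y0.
Qed.

Lemma LM_to_sdp_surjective p : exists x, LM_to_sdp x = p.
Proof.
case: p => [[[z a] pa]|]; last by exists null.
have /sdp_predP[/= g zg ga] := pa.
have [x kx] := @key_ex _ (ysat z, g) (conj (ysat_conf zg) zg).
by exists x; apply: sdp_val_inj; rewrite (sdp_val_key kx (esym ga)).
Qed.

(** Translating the union of [g^-1 . A] and [B] by [g] gives the union of [A] and [g . B], and
    translation preserves forks, so both products have the same value and vanish together. *)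
Lemma LM_to_sdpM x y : LM_to_sdp (x * y) = LM_to_sdp x * LM_to_sdp y.
Proof.
case kx : (key x) => [[A g]|]; last by rewrite (key_none kx).
have [z1 z1A] := conf_ysat (keyP kx).1; rewrite -[A]z1A in kx.
have sx := sdp_val_key kx erefl.
case ky : (key y) => [[B h]|]; last first.
  rewrite (key_none ky); have [_ _ R0] := LM_semigroup0 G; rewrite R0.
  by case: (LM_to_sdp x).
have [z2 z2B] := conf_ysat (keyP ky).1; rewrite -[B]z2B in ky.
have sy := sdp_val_key ky erefl.
have [/= cA Ag] := keyP kx; have [/= cB Bh] := keyP ky.
have [rg _] := conf_path cA Ag; have [rV gV] := pathV_rpath rg.
have E1 : ysat (theta_act (omega g)^-1 z1) = tr (pathV g) (ysat z1).
  by apply: theta_actE; rewrite // invgK.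
have cA' := conf_trV cA Ag.
pose z := theta_act (omega g) (theta_act (omega g)^-1 z1 * z2).
have mE : LM_to_sdp x * LM_to_sdp y = insub (z, omega g * omega h).
  case: (LM_to_sdp x) sx => // s [sE]; case: (LM_to_sdp y) sy => // t [tE].
  by change (sdp_mul (Some s) (Some t) = insub (z, omega g * omega h)); rewrite /sdp_mul (sE : val s = _) (tE : val t = _).
rewrite mE; have zE := ysatM (theta_act (omega g)^-1 z1) z2.
rewrite E1 (smul_conf cA' cB) in zE.
have trE : tr g (tr (pathV g) (ysat z1) `|` ysat z2)%classic =
    (ysat z1 `|` tr g (ysat z2))%classic by rewrite trU (conf_trVK cA Ag).
have [[gh fU]|nU] := pselect (prng g = psrc h /\ fork_free (ysat z1 `|` tr g (ysat z2))%classic).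
  rewrite asboolT in zE; last by split=> //; apply: (@fork_free_trW _ g); rewrite trE.
  have ez : ysat z = (ysat z1 `|` tr g (ysat z2))%classic.
    have zV : ysat (theta_act (omega g)^-1 z1 * z2) (pathV g).
      by rewrite zE; left; apply: conf_trVV cA Ag.
    by rewrite /z (theta_actE zV) ?omegaV // pathVK // zE trE.
  have kxy := keyM_some kx ky; rewrite /kmul asboolT //= -ez in kxy.
  apply: sdp_val_inj; rewrite (sdp_val_key kxy (esym (omegaM g h))).
  rewrite /sdp_val insubT //; apply/sdp_predP; exists (pathM g h); last exact: omegaM.
  by have [] := keyP kxy.
rewrite asboolF in zE.
  have kxy := keyM_some kx ky; rewrite /kmul asboolF // in kxy.
  rewrite (key_none kxy) insubF //; apply/negbTE/sdp_predP => -[g' /= + _].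
  by rewrite /z (ysat_eq0 zE) theta_act_null ysat_null.
move=> [gh fU]; apply: nU; split=> //; rewrite -trE; apply: fork_free_tr fU => p pU.
rewrite [prng g]gh.
case: pU => h'; last exact: conf_path cB h'.
by rewrite -gh; apply: conf_path cA' h'.
Qed.

Lemma LM_sdp_isomorphism : isomorphism0 LM_to_sdp.
Proof.
split; last by split=> //; apply: LM_to_sdpM.
have [k kK] := choice LM_to_sdp_surjective.
by exists k => // x; apply: LM_to_sdp_injective; rewrite kK.
Qed.

(** The first letter of a nonempty word carries the source; only vertices share an image. *)
Lemma omega_inj_neq1 g h : rpath g -> rpath h -> omega g <> 1 -> omega g = omega h -> g = h.
Proof.
move=> rg rh g1 gh; apply: omega_inj => //; case: g h rg rh g1 gh => [v w] [v' w'].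
move=> /andP[pg redg] /andP[ph redh] g1 /(fg_word_inj redg redh) /= ww'.
move: pg ph g1 {redg redh}; rewrite -ww' /is_path /=; case: w {ww'} => [|x w] /=.
  by rewrite -/(vpath v) omega_vpath.
by move=> /andP[/eqP <- _] /andP[/eqP].
Qed.

Lemma omega_neq1 v g : FC_at v g -> g <> vpath v -> omega g <> 1.
Proof.
move=> [Fg <-] gv; rewrite -(omega_vpath (psrc g)) => E; apply: gv.
exact: omega_inj (FC_rpath Fg) _ _ E.
Qed.

(** A nontrivial word comes from a single path, so every nonzero class in the domain has root [v],
    and its stripped tree is the preimage. For the word [1] all roots would occur. *)
Lemma theta_dom_bij v g : FC_at v g -> g <> vpath v ->
  set_bij [set T | X_L v T /\ pL g \in T]%classic
          (theta_dom (omega g) `\ null)%classic (@Yclass G).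
Proof.
move=> Fg gv; have g1 := omega_neq1 Fg gv; have rg := FC_rpath Fg.1; split.
- move=> T [/X_LP[XT _] pLT].
  have yg : ysat (Yclass T) g by rewrite (ysat_Yclass XT); apply/(satP _ (X_at_rooted XT)).
  by split; [right; exists g|apply: ysat_neq0 yg].
- move=> T S; rewrite !in_setE => -[XT _] [XS _] TS; apply: (X_L_inj XT XS).
  have [[XT' _] [XS' _]] := ((X_LP v T).1 XT, (X_LP v S).1 XS).
  by rewrite -(ysat_Yclass XT') -(ysat_Yclass XS') TS.
- move=> z [[//|[g' zg' gg']] _]; have cz := ysat_conf zg'.
  have [rg' _] := conf_path cz zg'.
  have E := omega_inj_neq1 rg rg' g1 (esym gg'); rewrite -{}E in zg' cz.
  have [T XT zT] := cz; have rT := X_at_rooted XT; rewrite Fg.2 in XT rT.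
  have XTL := X_L_TL XT; have [XTL' _] := (X_LP _ _).1 XTL; exists (TL T).
    split=> //; suff /(satP _ (X_at_rooted XTL'))[] : sat (TL T) g by [].
    by rewrite (sat_TL rT) -zT.
  by apply: ysat_inj; rewrite (ysat_Yclass XTL') (sat_TL rT).
Qed.

Lemma theta_act_Yclass v g T T' : FC_at v g ->
  X_L (prng g) T -> pL (pathV g) \in T -> representative T T' -> pathV g \in T' ->
  X_L v (TL (translate g T')) /\
  theta_act (omega g) (Yclass T) = Yclass (TL (translate g T')).
Proof.
move=> [Fg gv] XLT pLT /(representativeP _ XLT)[XT' sT'] gT'.
have [XT _] := (X_LP _ _).1 XLT; have rg := FC_rpath Fg.
have [rV gV] := pathV_rpath rg.
have [XU sU] := X_at_translateV XT' gT'; rewrite gV gv pathVK // in XU sU.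
have XLU := X_L_TL XU; have [XLU' _] := (X_LP _ _).1 XLU; split=> //.
apply: ysat_inj; rewrite (ysat_Yclass XLU') (sat_TL (X_at_rooted XU)) sU.
rewrite (@theta_actE _ _ _ (pathV g)) ?omegaV // (ysat_Yclass XT) ?pathVK ?sT' //.
by apply/(satP _ (X_at_rooted XT)).
Qed.

Lemma theta_dom_eq0 (a : free_group (edge G)) : (forall g, FC g -> omega g <> a) ->
  theta_dom a = [set null]%classic.
Proof.
move=> nh; apply/seteqP; split=> [z [//|[g zg gh]]|z ->]; last by left.
by case: (nh g (conf_FC (ysat_conf zg) zg) gh).
Qed.

End SemidirectProduct.

Lemma morphism0_inverse (S S' : magma0Type) (f : S -> S') (k : S' -> S) :
  morphism0 f -> cancel f k -> cancel k f -> morphism0 k.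
Proof.
move=> [fM f0] fK kK; split=> [x y|]; last by rewrite -f0 fK.
by rewrite -{1}(kK x) -{1}(kK y) -fM fK.
Qed.

Theorem theorem3p15 (G : sepgraph) :
  (* representatives containing the group element exist *)
  (forall (T : {fset gpath G}) (g : gpath G), is_LM (T, g) ->
     representative T (saturate T g) /\ g \in saturate T g)
  (* the Leavitt-Munn trees form an inverse semigroup with zero *)
  /\ inverse_semigroup0 (LM G)
  (* the product does not depend on the choice of representatives *)
  /\ (forall (T1 T2 T1' T2' : {fset gpath G}) (g1 g2 : gpath G),
        is_LM (T1, g1) -> is_LM (T2, g2) ->
        representative T1 T1' -> g1 \in T1' ->
        representative T2 T2' -> g2 \in T2' ->
        LM_val (toLM (T1, g1) * toLM (T2, g2)) = LM_prod T1' g1 T2' g2)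
  (* the inverse *)
  /\ (forall (T T' : {fset gpath G}) (g : gpath G),
        is_LM (T, g) -> representative T T' -> g \in T' ->
        let t := (TL (translate (pathV g) T'), pathV g) in
        is_LM t /\ is_inverse (toLM (T, g)) (toLM t))
  (* the isomorphism, the partial homomorphism and the decomposition *)
  /\ exists f : LI G -> LM G,
      [/\ isomorphism0 f,
          partial_homomorphism (fun x => LM_omega (f x)),
          idempotent_pure (fun x => LM_omega (f x)),
          semilattice0 (Y_L G) /\
          (exists phi : Y_L G -> LI G,
             morphism0 phi /\
             set_bij [set: Y_L G]%classic (@idempotents (LI G)) phi)
        & exists th : partial_action (free_group (edge G)) (Y_L G),
            [/\ forall (v : vertex G) (g : gpath G),
                  FC_at v g -> g <> vpath v ->
                  set_bij [set T | X_L v T /\ pL g \in T]%classic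
                          (pdom th (omega g) `\ null)%classic
                          (@Yclass G),
                forall (v : vertex G) (g : gpath G) (T T' : {fset gpath G}),
                  FC_at v g -> g <> vpath v ->
                  X_L (prng g) T -> pL (pathV g) \in T ->
                  representative T T' -> pathV g \in T' ->
                  X_L v (TL (translate g T')) /\
                  pact th (omega g) (Yclass T) = Yclass (TL (translate g T')),
                forall h : free_group (edge G), h <> 1 ->
                  (forall g : gpath G, FC g -> omega g <> h) ->
                  pdom th h = [set null]%classic
              & exists k : LI G -> sdp th,
                  isomorphism0 k /\
                  forall x T g, LM_val (f x) = Some (T, g) ->
                    sdp_val (k x) = Some (Yclass T, omega g)]].
Proof.
have [f isof] := LI_LM_isomorphism G; have [[k fK kK] [fM f0]] := isof.
have kM := morphism0_inverse isof.2 fK kK.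
split.
  move=> T g /is_LMP[XLT sg]; have [XT _] := (X_LP _ _).1 XLT.
  split; last exact: mem_saturate.
  by apply/(representativeP _ XLT); apply: saturateP.
split; first exact: LM_inverse_semigroup0.
split; first by move=> T1 T2 T1' T2' g1 g2; apply: toLM_mul.
split; first by move=> T T' g; apply: toLM_inverse.
exists f; split=> //.
- by move=> s t st0; rewrite fM; apply: LM_omegaM => fst; apply: st0; rewrite -(fK (s * t)) fM fst kM.2.
- move=> s s0; have fs0 : f s <> null by move=> fs; apply: s0; rewrite -(fK s) fs kM.2.
  split=> [/(LM_omega_pure fs0) e|e].
    by rewrite -(fK (s * s)) fM e fK.
  by apply/(LM_omega_pure fs0); rewrite -fM e.
- split; first exact: Y_semilattice0.
  (* The idempotents are identified in [LM] and carried to LI by the inverse isomorphism. *)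
  have [i [[iM i0] i_inj iP]] := Y_embedding G; exists (k \o i); split.
    by split=> [y z|] /=; rewrite ?iM ?kM.1 // i0 kM.2.
  split=> [y _|y z _ _|s ss].
  + by rewrite /idempotents /= -kM.1 (iP (i y)).2 //; exists y.
  + by move=> /(can_inj kK)/i_inj.
  + have [y yE] := (iP (f s)).1 (esym (etrans (congr1 f (esym ss)) (fM _ _))).
    by exists y => //=; rewrite yE fK.
- exists (theta G); split.
  + by move=> v g; apply: theta_dom_bij.
  + by move=> v g T T' Fg _; apply: theta_act_Yclass.
  + by move=> h _; apply: theta_dom_eq0.
  + have [[k' sK kS] [sM s0]] := LM_sdp_isomorphism G.
    exists (@LM_to_sdp G \o f); split; last by move=> x T g; apply: sdp_val_LM.
    split; last by split=> [s t|] /=; rewrite ?fM ?sM ?f0.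
    by exists (k \o k') => s /=; rewrite ?sK ?fK ?kK ?kS.
Qed.
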